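(* Let $\mathbb{A}$ be a strict monoidal category with free cornering ${}^\ulcorner_\llcorner\mathbb{A}^\urcorner_\lrcorner$. Let $n\geq 1$, let $A_1,B_1,\ldots,A_n,B_n$ be objects of $\mathbb{A}$, and let $X=A_1^\bullet\otimes B_1^\circ\otimes\cdots\otimes A_n^\bullet\otimes B_n^\circ$, an element of the vertical edge monoid of ${}^\ulcorner_\llcorner\mathbb{A}^\urcorner_\lrcorner$. Then there is a bijection $$ {}^\ulcorner_\llcorner\mathbb{A}^\urcorner_\lrcorner\left(I\,{I\atop I}\,X\right)\;\cong\;\int^{M_1,\ldots,M_{n-1}\in\mathbb{A}}\;\prod_{i=1}^n\mathbb{A}(M_{i-1}\otimes A_i,\;M_i\otimes B_i), $$ where $M_0=M_n=I$.
   Context: Conventions. Composition of arrows in $\mathbb{A}$ is written in diagrammatic order: $fg$ means first $f$, then $g$. All monoidal categories are strict; $\mathbb{A}_0$ is the set of objects of $\mathbb{A}$ and $I$ is the unit. The coend. The right-hand side is the coend in $\mathbf{Set}$ over the variables $M_1,\ldots,M_{n-1}$, each $M_i$ occurring covariantly in the $i$-th factor and contravariantly in the $(i+1)$-st factor (for $n=1$ there are no variables and it is just $\mathbb{A}(A_1,B_1)$). Single object double categories. A single object double category $\mathbb{D}$ is a double category with exactly one object. It consists of a horizontal edge monoid $(\mathbb{D}_H,\otimes,I)$, a vertical edge monoid $(\mathbb{D}_V,\otimes,I)$, and for all $A,B\in\mathbb{D}_H$, $X,Y\in\mathbb{D}_V$ a set $\mathbb{D}\left(X\,{A\atop B}\,Y\right)$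 (a cell-set) of cells with left boundary $X$, top boundary $A$, bottom boundary $B$, right boundary $Y$. Cells $\alpha\in\mathbb{D}\left(X\,{A\atop B}\,Y\right)$ and $\beta\in\mathbb{D}\left(Y\,{A'\atop B'}\,Z\right)$ have a horizontal composite $\alpha\vert\beta\in\mathbb{D}\left(X\,{A\otimes A'\atop B\otimes B'}\,Z\right)$; cells $\alpha\in\mathbb{D}\left(X\,{A\atop B}\,Y\right)$ and $\beta\in\mathbb{D}\left(X'\,{B\atop C}\,Y'\right)$ have a vertical composite $\frac{\alpha}{\beta}\in\mathbb{D}\left(X\otimes X'\,{A\atop C}\,Y\otimes Y'\right)$. Both compositions are associative and unital, with horizontal identity cells $\mathrm{id}_X\in\mathbb{D}\left(X\,{I\atop I}\,X\right)$ and vertical identity cells $1_A\in\mathbb{D}\left(I\,{A\atop A}\,I\right)$, compatible with the edge monoids as in any double category ($\mathrm{id}_{X\otimes Y}=\frac{\mathrm{id}_X}{\mathrm{id}_Y}$, $1_{A\otimes B}=1_A\vert 1_B$); the two identity cells of type $I$ coincide; and the interchange law $\frac{\alpha}{\beta}\vert\frac{\gamma}{\delta}=\frac{\alpha\vert\gamma}{\beta\vert\delta}$ holds. Free cornering. The free cornering ${}^\ulcorner_\llcorner\mathbb{A}^\urcorner_\lrcorner$ of $\mathbb{A}$ is the free single object double category on the following data. Its horizontal edge monoid is $(\mathbb{A}_0,\otimes,I)$. Its vertical edge monoid is the free monoid on the set $\mathbb{A}_0\times\{\circ,\bullet\}$, whose generators are written $A^\circ$ and $A^\bullet$ (with monoid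 operation $\otimes$ and unit $I$). The generating cells are: (1) for each $f:A\to B$ in $\mathbb{A}$, a cell $\ulcorner f\urcorner$ with left and right boundary $I$, top $A$, bottom $B$, subject to $\ulcorner fg\urcorner=\frac{\ulcorner f\urcorner}{\ulcorner g\urcorner}$, $\ulcorner 1_A\urcorner=1_A$, and $\ulcorner f\otimes g\urcorner=\ulcorner f\urcorner\vert\ulcorner g\urcorner$; (2) for each $A\in\mathbb{A}_0$, four corner cells, written here as $s^\circ_A\in\left(I\,{A\atop I}\,A^\circ\right)$, $r^\circ_A\in\left(A^\circ\,{I\atop A}\,I\right)$, $r^\bullet_A\in\left(I\,{I\atop A}\,A^\bullet\right)$, $s^\bullet_A\in\left(A^\bullet\,{A\atop I}\,I\right)$ (boundaries listed as left, top over bottom, right), subject to the yanking equations $s^\circ_A\vert r^\circ_A=1_A$, $\frac{r^\circ_A}{s^\circ_A}=\mathrm{id}_{A^\circ}$, $r^\bullet_A\vert s^\bullet_A=1_A$, $\frac{r^\bullet_A}{s^\bullet_A}=\mathrm{id}_{A^\bullet}$. That is, cells are all formal horizontal and vertical composites of generating cells and identity cells, modulo the axioms of a double category and the listed equations. *)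

(* Defs.v *)
From Stdlib Require Import FunctionalExtensionality Relation_Operators.
From mathcomp Require Import all_boot.

Set Implicit Arguments.
Unset Strict Implicit.
Unset Printing Implicit Defensive.

(* The set of classes of R, meant for an equivalence relation R. *)
Definition quotient (T : Type) (R : T -> T -> Prop) : Type :=
  {C : T -> Prop | exists x : T, C = R x}.

(* Composition is in diagrammatic order: [f ;; g] is first f, then g. *)
Record category := Category {
  obj :> Type;
  hom : obj -> obj -> Type;
  idm : forall a : obj, hom a a;
  mcomp : forall a b c : obj, hom a b -> hom b c -> hom a c;
  mcompA : forall (a b c d : obj) (f : hom a b) (g : hom b c) (h : hom c d),
    mcomp f (mcomp g h) = mcomp (mcomp f g) h;
  mcomp1m : forall (a b : obj) (f : hom a b), mcomp (idm a) f = f;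
  mcompm1 : forall (a b : obj) (f : hom a b), mcomp f (idm b) = f
}.

Arguments hom {C} a b : rename.
Arguments idm {C} a : rename.
Arguments mcomp {C a b c} f g : rename.

Notation "f ;; g" := (mcomp f g) (at level 50, left associativity).

Definition hom_cast (C : category) (a a' b b' : C) (ea : a = a') (eb : b = b')
    (f : hom a b) : hom a' b' :=
  match ea in _ = x, eb in _ = y return hom x y with
  | erefl, erefl => f
  end.

(* Strictness: the associativity and unit isomorphisms are equalities of
   objects, and the corresponding equations between arrows are stated up to
   transport along them. *)
Record strictMonoidal := StrictMonoidal {
  smcat :> category;
  tens : smcat -> smcat -> smcat;
  unito : smcat;
  tensA : forall a b c : smcat, tens a (tens b c) = tens (tens a b) c;
  tens1o : forall a : smcat, tens unito a = a;
  tenso1 : forall a : smcat, tens a unito = a;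
  tensm : forall a b a' b' : smcat,
    hom a b -> hom a' b' -> hom (tens a a') (tens b b');
  tensm_id : forall a b : smcat, tensm (idm a) (idm b) = idm (tens a b);
  tensm_comp : forall (a b c a' b' c' : smcat)
      (f : hom a b) (g : hom b c) (f' : hom a' b') (g' : hom b' c'),
    tensm (f ;; g) (f' ;; g') = tensm f f' ;; tensm g g';
  tensmA : forall (a b a' b' a'' b'' : smcat)
      (f : hom a b) (g : hom a' b') (h : hom a'' b''),
    hom_cast (tensA a a' a'') (tensA b b' b'') (tensm f (tensm g h))
    = tensm (tensm f g) h;
  tensm1m : forall (a b : smcat) (f : hom a b),
    hom_cast (tens1o a) (tens1o b) (tensm (idm unito) f) = f;
  tensmm1 : forall (a b : smcat) (f : hom a b),
    hom_cast (tenso1 a) (tenso1 b) (tensm f (idm unito)) = f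
}.

Arguments unito {AA} : rename.
Arguments tens {AA} a b : rename.
Arguments tensm {AA a b a' b'} f g : rename.

Notation "a ⊗ b" := (tens a b) (at level 40, left associativity).

(* [pf_ob F a b] is contravariant in a and covariant in b, i.e. F is a functor
   C^op * C -> Set. *)
Record endoprofunctor (C : category) := Endoprofunctor {
  pf_ob :> C -> C -> Type;
  pf_act : forall a' a b b' : C,
    hom a' a -> hom b b' -> pf_ob a b -> pf_ob a' b';
  pf_act_id : forall (a b : C) (x : pf_ob a b), pf_act (idm a) (idm b) x = x;
  pf_act_comp : forall (a'' a' a b b' b'' : C) (h' : hom a'' a') (h : hom a' a)
      (k : hom b b') (k' : hom b' b'') (x : pf_ob a b),
    pf_act (h' ;; h) (k ;; k') x = pf_act h' k' (pf_act h k x)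
}.

Arguments pf_act {C} F {a' a b b'} h k x : rename.

Inductive coend_step (C : category) (F : endoprofunctor C) :
    {a : C & F a a} -> {a : C & F a a} -> Prop :=
| CoendStep (a b : C) (h : hom a b) (x : F b a) :
    coend_step (existT (fun a => F a a) a (pf_act F h (idm a) x))
               (existT (fun a => F a a) b (pf_act F (idm b) h x)).

Definition coend (C : category) (F : endoprofunctor C) : Type :=
  quotient (clos_refl_sym_trans {a : C & F a a} (@coend_step C F)).

Definition power (J : Type) (C : category) : category.
Proof.
refine (@Category (J -> C) (fun M N => forall j, hom (M j) (N j))
  (fun M j => idm (M j)) (fun M N P f g j => f j ;; g j) _ _ _).
- by move=> *; apply: functional_extensionality_dep => j; apply: mcompA.
- by move=> *; apply: functional_extensionality_dep => j; apply: mcomp1m.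
- by move=> *; apply: functional_extensionality_dep => j; apply: mcompm1.
Defined.

Section Chain.
Variables (AA : strictMonoidal) (m : nat).

(* With n = m + 1, the variables M_1, ..., M_(n-1) are M : 'I_m -> AA shifted
   down by one, and the factors i = 1, ..., n are likewise indexed by
   'I_m.+1.  [unlift ord0 i] and [unlift ord_max i] locate M_(i-1) and M_i;
   they are None exactly for M_0 and M_n, which are the unit. *)
Definition ext_ob (M : 'I_m -> AA) (o : option 'I_m) : AA :=
  if o is Some j then M j else unito.

Definition ext_hom (M N : power 'I_m AA) (h : hom M N) (o : option 'I_m) :
    hom (ext_ob M o) (ext_ob N o) :=
  match o return hom (ext_ob M o) (ext_ob N o) with
  | Some j => h j
  | None => idm unito
  end.

Variables A B : 'I_m.+1 -> AA.

Definition chain_ob (P M : power 'I_m AA) : Type :=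
  forall i : 'I_m.+1,
    hom (ext_ob P (unlift ord0 i) ⊗ A i) (ext_ob M (unlift ord_max i) ⊗ B i).

Definition chain_act (P' P M M' : power 'I_m AA) (h : hom P' P) (k : hom M M')
    (x : chain_ob P M) : chain_ob P' M' :=
  fun i => tensm (ext_hom h (unlift ord0 i)) (idm (A i)) ;; x i
           ;; tensm (ext_hom k (unlift ord_max i)) (idm (B i)).

Lemma ext_hom_id (M : power 'I_m AA) o : ext_hom (idm M) o = idm (ext_ob M o).
Proof. by case: o. Qed.

Lemma ext_hom_comp (M N P : power 'I_m AA) (h : hom M N) (k : hom N P) o :
  ext_hom (h ;; k) o = ext_hom h o ;; ext_hom k o.
Proof. by case: o => //=; rewrite mcomp1m. Qed.

Definition chain : endoprofunctor (power 'I_m AA).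
Proof.
refine (@Endoprofunctor _ chain_ob chain_act _ _).
- move=> P M x; apply: functional_extensionality_dep => i.
  by rewrite /chain_act !ext_hom_id !tensm_id mcomp1m mcompm1.
- move=> P'' P' P M M' M'' h' h k k' x; apply: functional_extensionality_dep => i.
  rewrite /chain_act !ext_hom_comp -{1}[idm (A i)]mcomp1m.
  by rewrite -{1}[idm (B i)]mcomp1m !tensm_comp !mcompA.
Defined.
End Chain.

Inductive polarity := circ | bullet.

Section Cornering.
Variable AA : strictMonoidal.

Definition vmon : Type := seq (AA * polarity).

(* [cell X A B Y] has left boundary X, top A, bottom B and right boundary Y. *)
Inductive cell : vmon -> AA -> AA -> vmon -> Type :=
| Gen (A B : AA) (f : hom A B) : cell [::] A B [::]
| Scirc (A : AA) : cell [::] A unito [:: (A, circ)]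
| Rcirc (A : AA) : cell [:: (A, circ)] unito A [::]
| Rbullet (A : AA) : cell [::] unito A [:: (A, bullet)]
| Sbullet (A : AA) : cell [:: (A, bullet)] A unito [::]
| Hid (X : vmon) : cell X unito unito X
| Vid (A : AA) : cell [::] A A [::]
| Hcomp (X Y Z : vmon) (A B A' B' : AA) :
    cell X A B Y -> cell Y A' B' Z -> cell X (A ⊗ A') (B ⊗ B') Z
| Vcomp (X X' Y Y' : vmon) (A B C : AA) :
    cell X A B Y -> cell X' B C Y' -> cell (X ++ X') A C (Y ++ Y').

(* The boundaries of the two sides of an equation agree only up to the monoid
   laws, so the relation is heterogeneous; [cell_eq_boundary] shows that it
   never relates cells with different boundaries. *)
Inductive cell_eq : forall (X Y X' Y' : vmon) (A B A' B' : AA),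
    cell X A B Y -> cell X' A' B' Y' -> Prop :=
| ceq_refl X A B Y (a : cell X A B Y) : cell_eq a a
| ceq_sym X A B Y X' A' B' Y' (a : cell X A B Y) (a' : cell X' A' B' Y') :
    cell_eq a a' -> cell_eq a' a
| ceq_trans X A B Y X' A' B' Y' X'' A'' B'' Y''
    (a : cell X A B Y) (a' : cell X' A' B' Y') (a'' : cell X'' A'' B'' Y'') :
    cell_eq a a' -> cell_eq a' a'' -> cell_eq a a''
| ceq_Hcomp X Y Z A B C D X' Y' Z' A' B' C' D'
    (a : cell X A B Y) (b : cell Y C D Z)
    (a' : cell X' A' B' Y') (b' : cell Y' C' D' Z') :
    cell_eq a a' -> cell_eq b b' -> cell_eq (Hcomp a b) (Hcomp a' b')
| ceq_Vcomp X Y Z W A B C X' Y' Z' W' A' B' C'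
    (a : cell X A B Y) (b : cell Z B C W)
    (a' : cell X' A' B' Y') (b' : cell Z' B' C' W') :
    cell_eq a a' -> cell_eq b b' -> cell_eq (Vcomp a b) (Vcomp a' b')
| ceq_HcompA X Y Z W A B A' B' A'' B''
    (a : cell X A B Y) (b : cell Y A' B' Z) (c : cell Z A'' B'' W) :
    cell_eq (Hcomp a (Hcomp b c)) (Hcomp (Hcomp a b) c)
| ceq_Hcomp1c X A B Y (a : cell X A B Y) : cell_eq (Hcomp (Hid X) a) a
| ceq_Hcompc1 X A B Y (a : cell X A B Y) : cell_eq (Hcomp a (Hid Y)) a
| ceq_VcompA X Y X' Y' X'' Y'' A B C D
    (a : cell X A B Y) (b : cell X' B C Y') (c : cell X'' C D Y'') :
    cell_eq (Vcomp a (Vcomp b c)) (Vcomp (Vcomp a b) c)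
| ceq_Vcomp1c X A B Y (a : cell X A B Y) : cell_eq (Vcomp (Vid A) a) a
| ceq_Vcompc1 X A B Y (a : cell X A B Y) : cell_eq (Vcomp a (Vid B)) a
| ceq_Hid X Y : cell_eq (Hid (X ++ Y)) (Vcomp (Hid X) (Hid Y))
| ceq_Vid A B : cell_eq (Vid (A ⊗ B)) (Hcomp (Vid A) (Vid B))
| ceq_HVid : cell_eq (Hid [::]) (Vid unito)
| ceq_interchange X Y Z X' Y' Z' A B C A' B' C'
    (a : cell X A B Y) (b : cell X' B C Y')
    (c : cell Y A' B' Z) (d : cell Y' B' C' Z') :
    cell_eq (Hcomp (Vcomp a b) (Vcomp c d)) (Vcomp (Hcomp a c) (Hcomp b d))
| ceq_Gen_comp A B C (f : hom A B) (g : hom B C) :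
    cell_eq (Gen (f ;; g)) (Vcomp (Gen f) (Gen g))
| ceq_Gen_id A : cell_eq (Gen (idm A)) (Vid A)
| ceq_Gen_tens A B A' B' (f : hom A B) (g : hom A' B') :
    cell_eq (Gen (tensm f g)) (Hcomp (Gen f) (Gen g))
| ceq_circ_h A : cell_eq (Hcomp (Scirc A) (Rcirc A)) (Vid A)
| ceq_circ_v A : cell_eq (Vcomp (Rcirc A) (Scirc A)) (Hid [:: (A, circ)])
| ceq_bullet_h A : cell_eq (Hcomp (Rbullet A) (Sbullet A)) (Vid A)
| ceq_bullet_v A :
    cell_eq (Vcomp (Rbullet A) (Sbullet A)) (Hid [:: (A, bullet)]).

Lemma cell_eq_boundary X Y X' Y' A B A' B'
    (a : cell X A B Y) (a' : cell X' A' B' Y') :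
  cell_eq a a' -> [/\ X = X', A = A', B = B' & Y = Y'].
Proof.
elim=> //=; clear; intros;
  repeat match goal with H : and4 _ _ _ _ |- _ => case: H => ? ? ? ?; subst end;
  by rewrite ?cats0 ?catA ?tensA ?tens1o ?tenso1.
Qed.

Definition cornering (X : vmon) (A B : AA) (Y : vmon) : Type :=
  quotient (fun a b : cell X A B Y => cell_eq a b).

End Cornering.

(* Main.v *)
Require Import Defs.
From Stdlib Require Import Eqdep PropExtensionality ProofIrrelevance
  FunctionalExtensionality.
From Stdlib Require Import Relation_Operators.
From mathcomp Require Import all_boot.

Set Implicit Arguments.
Unset Strict Implicit.
Unset Printing Implicit Defensive.

(** A vertical edge X is read as a profunctor on AA.  The letters A° and A•
    are the two profunctors represented by the functor - ⊗ A, namely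
    hom(M, K ⊗ A) and hom(M ⊗ A, K), and concatenation of words is composition
    of profunctors, a coend.  [comb X M N] is the set of elements of that
    composite before the quotient by sliding, and [comb_eq] is the sliding.

    A cell with left, top, bottom and right boundaries X, A, B, Y acts as a
    family of maps from [comb X M N] to [comb Y (M ⊗ A) (N ⊗ B)], natural in M
    and N; this is [sem].  The corner cells are the unit and counit making A°
    and A• adjoint, so the yanking equations hold, and [soundness] says that
    equal cells act equally.  In particular a cell from the empty word to X
    with top and bottom the unit gives an element of [comb X I I], the image
    of the identity of I.

    That element determines the cell.  Every comb x can be drawn as a cell
    [realize x], and drawing x to the left of a cell is the same as drawing the
    result of the action on x ([realize_sem]).  With x an identity this
    recovers a cell from its action ([cell_eq_sem]).  Conversely a drawn comb
    acts on the identity by giving back the comb ([sem_realize]).  Hence the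
    cell-set is the profunctor of X evaluated at the unit twice.

    For the alternating word, the object between A_i• and B_i° is removed by
    the co-Yoneda lemma: arrows M ⊗ A -> L and L -> K ⊗ B only matter through
    their composite.  The trailing arrow of the comb is absorbed in the last
    composite.  What remains is a sequence of arrows
    M_(i-1) ⊗ A_i -> M_i ⊗ B_i up to sliding at the M_i ([links_combP]), which
    is the coend of the statement ([chain_linksP]).

    As the monoid laws of objects and words are mere equalities, elements of
    sets indexed by different but equal boundaries have to be compared.
    Identity arrows along equations between objects act on combs in place of
    transport, and [sim] compares combs across equal boundaries, so that such
    actions can be dropped. *)

(** * Quotients *)

Local Notation rst := (@clos_refl_sym_trans _).

Lemma rst_map (T U : Type) (R : T -> T -> Prop) (S : U -> U -> Prop)
    (f : T -> U) :
  (forall x y, R x y -> rst S (f x) (f y)) ->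
  forall x y, rst R x y -> rst S (f x) (f y).
Proof.
move=> RS x y; elim=> [{}x {}y /RS //|{}x|{}x {}y _|{}x {}y z _ xy _].
- exact: rst_refl.
- exact: rst_sym.
- exact: rst_trans.
Qed.

Lemma rst_eq (T U : Type) (R : T -> T -> Prop) (f : T -> U) :
  (forall x y, R x y -> f x = f y) -> forall x y, rst R x y -> f x = f y.
Proof.
by move=> RS x y; elim=> [{}x {}y /RS //|//|{}x {}y _ ->//|{}x {}y z _ -> _ ->].
Qed.

(** Two quotients agree as soon as both map faithfully and essentially onto a
    common set with an equivalence E.  A class is sent to all elements whose
    image meets the same E-class, so no representative is ever chosen. *)
Lemma quotient_cospan (T U W : Type) (R : T -> T -> Prop) (S : U -> U -> Prop)
    (E : W -> W -> Prop) (f : T -> W) (g : U -> W) :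
  (forall x, E x x) -> (forall x y, E x y -> E y x) ->
  (forall x y z, E x y -> E y z -> E x z) ->
  (forall a b, R a b <-> E (f a) (f b)) -> (forall u v, S u v <-> E (g u) (g v)) ->
  (forall w, exists a, E (f a) w) -> (forall w, exists u, E (g u) w) ->
  exists phi : quotient R -> quotient S, bijective phi.
Proof.
move=> Er Es Et RE SE fs gs.
have mk (V V' : Type) (P : V -> V -> Prop) (Q : V' -> V' -> Prop)
    (p : V -> W) (q : V' -> W) :
    (forall a b, P a b <-> E (p a) (p b)) ->
    (forall u v, Q u v <-> E (q u) (q v)) -> (forall w, exists u, E (q u) w) ->
    forall C : V -> Prop, (exists x, C = P x) ->
    exists y, (fun u => exists2 a, C a & E (p a) (q u)) = Q y.
  move=> PE QE qs C [a ->]; have [u ua] := qs (p a); exists u.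
  apply: functional_extensionality => v; apply: propositional_extensionality.
  split=> [[b /PE ab bv]|/QE uv]; first by apply/QE; apply: Et ua (Et _ _ _ ab bv).
  by exists a; [apply/PE | apply: Et (Es _ _ ua) uv].
pose phi (C : quotient R) : quotient S := exist _ _ (mk _ _ _ _ f g RE SE gs _ (svalP C)).
pose psi (D : quotient S) : quotient R := exist _ _ (mk _ _ _ _ g f SE RE fs _ (svalP D)).
have inv (V V' : Type) (P : V -> V -> Prop) (p : V -> W) (q : V' -> W) (C : V -> Prop) :
    (forall a b, P a b <-> E (p a) (p b)) -> (forall w, exists u, E (q u) w) ->
    (exists x, C = P x) ->
    (fun a => exists2 u, exists2 b, C b & E (p b) (q u) & E (q u) (p a)) = C.
  move=> PE qs [a ->]; apply: functional_extensionality => b.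
  apply: propositional_extensionality; split=> [[u [c /PE ac cu] ub]|/PE ab].
    by apply/PE; apply: Et ac (Et _ _ _ cu ub).
  have [u ub] := qs (p b); exists u => //; exists b; first exact/PE.
  exact: Es.
have qinj (V : Type) (P : V -> V -> Prop) (C D : quotient P) : sval C = sval D -> C = D.
  case: C D => [C c] [D d] /= CD; case: _ / CD d => d.
  by congr exist; apply: proof_irrelevance.
exists phi; exists psi => [C|D]; apply: qinj => /=.
  exact: inv RE gs (svalP C).
exact: inv SE fs (svalP D).
Qed.

(** * Arrows up to equality of their ends *)

Section Arrows.
Variable C : category.

(** Equality of arrows packed with their ends compares arrows whose ends are
    equal without being convertible. *)
Definition arrow : Type := {a : C & {b : C & hom a b}}.

Definition arr (a b : C) (f : hom a b) : arrow := existT _ a (existT _ b f).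

Lemma arr_inj (a b : C) (f g : hom a b) : arr f = arr g -> f = g.
Proof. by move=> fg; apply: inj_pairT2 (inj_pairT2 _ _ _ _ _ fg). Qed.

Lemma arr_mcomp (a b c a' b' c' : C) (f : hom a b) (g : hom b c)
    (f' : hom a' b') (g' : hom b' c') :
  arr f = arr f' -> arr g = arr g' -> arr (f ;; g) = arr (f' ;; g').
Proof.
move=> ff gg; have ea : a = a' := f_equal (@projT1 _ _) ff.
have eb : b = b' := f_equal (@projT1 _ _) gg.
have ec : c = c' := f_equal (fun x : arrow => projT1 (projT2 x)) gg.
by subst; rewrite (arr_inj ff) (arr_inj gg).
Qed.

Lemma arr_mcompm1 (a b c d : C) (f : hom a b) (g : hom b c) :
  arr g = arr (idm d) -> arr (f ;; g) = arr f.
Proof.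
move=> gd; have eb : b = d := f_equal (@projT1 _ _) gd.
have ec : c = d := f_equal (fun x : arrow => projT1 (projT2 x)) gd.
by subst; rewrite (arr_inj gd) mcompm1.
Qed.

Lemma arr_cast (a b a' b' : C) (ea : a = a') (eb : b = b') (f : hom a b) :
  arr (hom_cast ea eb f) = arr f.
Proof. by case: _ / ea; case: _ / eb. Qed.

(** Composing with these identities replaces transport along an equation, and
    the coherence of the transports becomes naturality. *)
Definition idc (a b : C) (e : a = b) : hom a b := hom_cast erefl e (idm a).

Lemma arr_idcl (a b c : C) (e : a = b) (f : hom b c) : arr (idc e ;; f) = arr f.
Proof. by case: _ / e f => f; rewrite mcomp1m. Qed.

Lemma arr_idcr (a b c : C) (f : hom a b) (e : b = c) : arr (f ;; idc e) = arr f.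
Proof. by case: _ / e; rewrite mcompm1. Qed.

Lemma arr_idc (a b : C) (e : a = b) : arr (idc e) = arr (idm a).
Proof. by case: _ / e. Qed.

End Arrows.

(** * Combs: the profunctor of a vertical edge *)

Section Tensor.
Variable AA : strictMonoidal.
Implicit Types M N K A B : AA.

Definition whisk A M N (f : hom M N) : hom (M ⊗ A) (N ⊗ A) := tensm f (idm A).

Lemma whisk_id A M : whisk A (idm M) = idm (M ⊗ A).
Proof. exact: tensm_id. Qed.

Lemma whisk_comp A M N K (f : hom M N) (g : hom N K) :
  whisk A (f ;; g) = whisk A f ;; whisk A g.
Proof. by rewrite /whisk -tensm_comp mcomp1m. Qed.

Lemma tensm_whiskl M N K A B (h : hom M N) (f : hom N K) (g : hom A B) :
  tensm (h ;; f) g = whisk A h ;; tensm f g.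
Proof. by rewrite -tensm_comp mcomp1m. Qed.

Lemma tensm_whiskr M N K A B (f : hom M N) (h : hom N K) (g : hom A B) :
  tensm (f ;; h) g = tensm f g ;; whisk B h.
Proof. by rewrite -tensm_comp mcompm1. Qed.

Lemma arr_tensm M N A B M' N' A' B' (f : hom M N) (g : hom A B)
    (f' : hom M' N') (g' : hom A' B') :
  arr f = arr f' -> arr g = arr g' -> arr (tensm f g) = arr (tensm f' g').
Proof.
move=> ff gg; have ea : M = M' := f_equal (@projT1 _ _) ff.
have eb : A = A' := f_equal (@projT1 _ _) gg.
have ec : N = N' := f_equal (fun x : arrow _ => projT1 (projT2 x)) ff.
have ed : B = B' := f_equal (fun x : arrow _ => projT1 (projT2 x)) gg.
by subst; rewrite (arr_inj ff) (arr_inj gg).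
Qed.

Lemma arr_tensmA M N A B A' B' (f : hom M N) (g : hom A B) (h : hom A' B') :
  arr (tensm f (tensm g h)) = arr (tensm (tensm f g) h).
Proof. by rewrite -tensmA arr_cast. Qed.

Lemma arr_tensm1m M N (f : hom M N) : arr (tensm (idm unito) f) = arr f.
Proof. by rewrite -{2}(tensm1m f) arr_cast. Qed.

Lemma arr_tensmm1 M N (f : hom M N) : arr (tensm f (idm unito)) = arr f.
Proof. by rewrite -{2}(tensmm1 f) arr_cast. Qed.

Lemma arr_whisk A M N M' N' (f : hom M N) (f' : hom M' N') :
  arr f = arr f' -> arr (whisk A f) = arr (whisk A f').
Proof. by move=> ff; apply: arr_tensm. Qed.

Lemma arr_whisk1 M N (f : hom M N) : arr (whisk unito f) = arr f.
Proof. exact: arr_tensmm1. Qed.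

Lemma arr_whiskA A B M N (f : hom M N) :
  arr (whisk (A ⊗ B) f) = arr (whisk B (whisk A f)).
Proof. by rewrite /whisk -tensm_id arr_tensmA. Qed.

Lemma whisk1_idc M N (f : hom M N) :
  whisk unito f ;; idc (tenso1 N) = idc (tenso1 M) ;; f.
Proof. by apply: arr_inj; rewrite arr_idcr arr_idcl arr_whisk1. Qed.

Lemma idc_whisk1 M N (f : hom M N) :
  f ;; idc (esym (tenso1 N)) = idc (esym (tenso1 M)) ;; whisk unito f.
Proof. by apply: arr_inj; rewrite arr_idcr arr_idcl arr_whisk1. Qed.

Lemma whiskA_idc A B M N (f : hom M N) :
  whisk (A ⊗ B) f ;; idc (tensA N A B) = idc (tensA M A B) ;; whisk B (whisk A f).
Proof. by apply: arr_inj; rewrite arr_idcr arr_idcl arr_whiskA. Qed.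

Lemma idc_whiskA A B M N (f : hom M N) :
  whisk B (whisk A f) ;; idc (esym (tensA N A B))
  = idc (esym (tensA M A B)) ;; whisk (A ⊗ B) f.
Proof. by apply: arr_inj; rewrite arr_idcr arr_idcl arr_whiskA. Qed.

(** The two profunctors represented by - ⊗ A, one in each variance.  They are
    adjoint, which is what the corner cells express. *)
Definition strand (p : AA * polarity) M K : Type :=
  if p.2 is circ then hom M (K ⊗ p.1) else hom (M ⊗ p.1) K.

Definition strandl p M' M K (h : hom M' M) : strand p M K -> strand p M' K :=
  match p return strand p M K -> strand p M' K with
  | (A, circ) => fun f => h ;; f
  | (A, bullet) => fun f => whisk A h ;; f
  end.

Definition strandr p M K K' (k : hom K K') : strand p M K -> strand p M K' :=
  match p return strand p M K -> strand p M K' with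
  | (A, circ) => fun f => f ;; whisk A k
  | (A, bullet) => fun f => f ;; k
  end.

Lemma strandl_id p M K (f : strand p M K) : strandl (idm M) f = f.
Proof. by case: p f => A [] f /=; rewrite ?whisk_id mcomp1m. Qed.

Lemma strandl_comp p M M' M'' K (h : hom M M') (h' : hom M' M'') (f : strand p M'' K) :
  strandl (h ;; h') f = strandl h (strandl h' f).
Proof. by case: p f => A [] f /=; rewrite ?whisk_comp mcompA. Qed.

Lemma strandlr p M M' K K' (h : hom M M') (k : hom K K') (f : strand p M' K) :
  strandl h (strandr k f) = strandr k (strandl h f).
Proof. by case: p f => A [] f /=; rewrite mcompA. Qed.

(** Elements of the composite of the profunctors of the letters of X, with
    explicit objects between the letters, before the quotient of the coend.
    The arrow that ends a comb keeps composition with the hom profunctor, the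
    unit of composition, from being a special case. *)
Fixpoint comb (X : vmon AA) M N : Type :=
  if X is p :: X' then {K : AA & strand p M K * comb X' K N}%type else hom M N.

Definition glue p X M K N (f : strand p M K) (r : comb X K N) : comb (p :: X) M N :=
  existT _ K (f, r).

Definition lact X M' M N : hom M' M -> comb X M N -> comb X M' N :=
  match X return hom M' M -> comb X M N -> comb X M' N with
  | [::] => fun h x => h ;; x
  | p :: X' => fun h x => glue (strandl h (projT2 x).1) (projT2 x).2
  end.

Fixpoint ract X : forall M N N', comb X M N -> hom N N' -> comb X M N' :=
  match X return forall M N N', comb X M N -> hom N N' -> comb X M N' with
  | [::] => fun _ _ _ x k => x ;; k
  | p :: X' => fun _ _ _ x k => glue (projT2 x).1 (ract (projT2 x).2 k)
  end.

(** The relation of the coend at the object after the first letter: an arrow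
    there belongs to the strand on its left or to the comb on its right. *)
Inductive slide p X (R : forall M N, comb X M N -> comb X M N -> Prop) M N :
    comb (p :: X) M N -> comb (p :: X) M N -> Prop :=
| Slide K K' (f : strand p M K) (h : hom K K') (r : comb X K' N) :
    slide R (glue (strandr h f) r) (glue f (lact h r))
| SlideTail K (f : strand p M K) (r r' : comb X K N) :
    R K N r r' -> slide R (glue f r) (glue f r').

(** By recursion on the word, so that an equivalence at a known word can be
    inverted without analysing the indices of an inductive predicate. *)
Fixpoint comb_eq X : forall M N, comb X M N -> comb X M N -> Prop :=
  match X return forall M N, comb X M N -> comb X M N -> Prop with
  | [::] => fun M N f g => f = g
  | p :: X' => fun M N => rst (slide (@comb_eq X') (M := M) (N := N))
  end.

Lemma comb_refl X M N (x : comb X M N) : comb_eq x x.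
Proof. by case: X x => // p X x; apply: rst_refl. Qed.

Lemma comb_sym X M N (x y : comb X M N) : comb_eq x y -> comb_eq y x.
Proof. by case: X x y => // p X x y; apply: rst_sym. Qed.

Lemma comb_trans X M N (x y z : comb X M N) : comb_eq x y -> comb_eq y z -> comb_eq x z.
Proof. by case: X x y z => [|p X] x y z; [apply: etrans | apply: rst_trans]. Qed.

Lemma glue_slide p X M K K' N (f : strand p M K) (h : hom K K') (r : comb X K' N) :
  comb_eq (glue (strandr h f) r) (glue f (lact h r)).
Proof. by apply: rst_step; constructor. Qed.

Lemma glue_eq p X M K N (f : strand p M K) (r r' : comb X K N) :
  comb_eq r r' -> comb_eq (glue f r) (glue f r').
Proof. by move=> rr; apply: rst_step; constructor. Qed.

Lemma lact_id X M N (x : comb X M N) : lact (idm M) x = x.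
Proof.
case: X x => [|p X] /= x; first exact: mcomp1m.
by case: x => K [f r]; rewrite strandl_id.
Qed.

Lemma lact_comp X M M' M'' N (h : hom M M') (h' : hom M' M'') (x : comb X M'' N) :
  lact (h ;; h') x = lact h (lact h' x).
Proof. by case: X x => [|p X] /= x; [rewrite mcompA | rewrite strandl_comp]. Qed.

Lemma ract_id X M N (x : comb X M N) : ract x (idm N) = x.
Proof.
elim: X M x => [|p X IH] M /= x; first exact: mcompm1.
by case: x => K [f r]; rewrite IH.
Qed.

Lemma ract_comp X M N N' N'' (x : comb X M N) (k : hom N N') (k' : hom N' N'') :
  ract x (k ;; k') = ract (ract x k) k'.
Proof. by elim: X M x => [|p X IH] M /= x; [rewrite mcompA | rewrite IH]. Qed.

Lemma lract X M M' N N' (h : hom M M') (x : comb X M' N) (k : hom N N') :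
  lact h (ract x k) = ract (lact h x) k.
Proof. by case: X x => [|p X] /= x; rewrite ?mcompA. Qed.

Lemma lact_eq X M M' N (h : hom M M') (x y : comb X M' N) :
  comb_eq x y -> comb_eq (lact h x) (lact h y).
Proof.
case: X x y => [|p X] /= x y; first by move->.
apply: (rst_map (f := @lact (p :: X) M M' N h)) => {x y} _ _ [K K' f k r|K f r r' rr] /=.
  by rewrite strandlr; apply: glue_slide.
exact: glue_eq.
Qed.

Lemma ract_eq X M N N' (k : hom N N') (x y : comb X M N) :
  comb_eq x y -> comb_eq (ract x k) (ract y k).
Proof.
elim: X M x y => [|p X IH] M /= x y; first by move->.
apply: (rst_map (f := (@ract (p :: X) M N N')^~ k)) =>
  {x y} _ _ [K K' f h r|K f r r' rr] /=.
  by rewrite -lract; apply: glue_slide.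
by apply: glue_eq; apply: IH.
Qed.

(** * Cutting combs *)

Fixpoint cat_comb X Y : forall M K N, comb X M K -> comb Y K N -> comb (X ++ Y) M N :=
  match X return forall M K N, comb X M K -> comb Y K N -> comb (X ++ Y) M N with
  | [::] => fun _ _ _ f y => lact f y
  | p :: X' => fun _ _ _ x y => glue (projT2 x).1 (cat_comb (projT2 x).2 y)
  end.

(** The composite of the profunctors of X and Y, with a distinguished object
    between the two words. *)
Definition cut X Y M N : Type := {K : AA & comb X M K * comb Y K N}%type.

Definition Cut X Y M K N (x : comb X M K) (y : comb Y K N) : cut X Y M N :=
    existT _ K (x, y).

Definition glue_cut p X Y M K N (f : strand p M K) (c : cut X Y K N) :
    cut (p :: X) Y M N := Cut (glue f (projT2 c).1 : comb (p :: X) _ _) (projT2 c).2.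

Fixpoint split_comb X Y : forall M N, comb (X ++ Y) M N -> cut X Y M N :=
  match X return forall M N, comb (X ++ Y) M N -> cut X Y M N with
  | [::] => fun M N z => Cut (idm M : comb [::] M M) z
  | p :: X' => fun M N z => glue_cut (projT2 z).1 (split_comb (projT2 z).2)
  end.

Inductive cut_step X Y M N : cut X Y M N -> cut X Y M N -> Prop :=
| CutSlide K K' (x : comb X M K) (h : hom K K') (y : comb Y K' N) :
    cut_step (Cut (ract x h) y) (Cut x (lact h y))
| CutEq K (x x' : comb X M K) (y y' : comb Y K N) :
    comb_eq x x' -> comb_eq y y' -> cut_step (Cut x y) (Cut x' y').

Local Notation cut_eq := (rst (@cut_step _ _ _ _)).

Lemma cat_lact X Y M' M K N (h : hom M' M) (x : comb X M K) (y : comb Y K N) :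
  cat_comb (lact h x) y = lact h (cat_comb x y).
Proof. by case: X x => [|p X] /= x; rewrite ?lact_comp. Qed.

Lemma cat_ract X Y M K N N' (x : comb X M K) (y : comb Y K N) (k : hom N N') :
  cat_comb x (ract y k) = ract (cat_comb x y) k.
Proof. by elim: X M x => [|p X IH] M /= x; rewrite ?lract ?IH. Qed.

Lemma cat_bal X Y M K K' N (x : comb X M K) (h : hom K K') (y : comb Y K' N) :
  cat_comb (ract x h) y = cat_comb x (lact h y).
Proof. by elim: X M x => [|p X IH] M /= x; rewrite ?lact_comp ?IH. Qed.

Lemma cat_eq X Y M K N (x x' : comb X M K) (y y' : comb Y K N) :
  comb_eq x x' -> comb_eq y y' -> comb_eq (cat_comb x y) (cat_comb x' y').
Proof.
move=> xx yy; have yx : comb_eq (cat_comb x y) (cat_comb x y').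
  elim: X M x {x' xx} => [|p X IH] M /= x; first exact: lact_eq.
  exact: glue_eq.
apply: comb_trans yx _ => {yy y}.
elim: X M x x' xx => [|p X IH] M /= x x'; first by move->; apply: comb_refl.
apply: (rst_map (f := fun x : comb (p :: X) M K => cat_comb x y')) =>
  {x x'} _ _ [L L' f h r|L f r r' rr] /=.
  by rewrite cat_lact; apply: glue_slide.
by apply: glue_eq; apply: IH.
Qed.

Lemma splitK X Y M N (z : comb (X ++ Y) M N) :
  cat_comb (projT2 (split_comb z)).1 (projT2 (split_comb z)).2 = z.
Proof.
elim: X M z => [|p X IH] M /= z; first exact: lact_id.
by case: z => K [f r] /=; rewrite IH.
Qed.

Lemma split_combP X Y M N (z : comb (X ++ Y) M N) :
  exists K (x : comb X M K) (y : comb Y K N), z = cat_comb x y.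
Proof.
by rewrite -(splitK z); case: (split_comb z) => K [x y]; exists K, x, y.
Qed.

Lemma glue_cut_eq p X Y M K N (f : strand p M K) (c d : cut X Y K N) :
  cut_eq c d -> cut_eq (glue_cut f c) (glue_cut f d).
Proof.
apply: (rst_map (f := glue_cut f)) => {c d} _ _ [L L' x h y|L x x' y y' xx yy].
  apply: rst_step; exact: (CutSlide (glue f x : comb (p :: X) _ _)).
by apply: rst_step; apply: CutEq => //; apply: glue_eq.
Qed.

(** Cutting off the empty word inserts an identity, so the action on the left
    passes into the first part only after a slide. *)
Lemma split_lact X Y M' M N (h : hom M' M) (z : comb (X ++ Y) M N) :
  cut_eq (split_comb (lact h z))
    (Cut (lact h (projT2 (split_comb z)).1) (projT2 (split_comb z)).2).
Proof.
case: X z => [|p X] /= z; last exact: rst_refl.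
rewrite mcompm1; apply: rst_sym; apply: rst_step.
by rewrite -{1}[h]mcomp1m; apply: (CutSlide (idm M' : comb [::] _ _)).
Qed.

Lemma split_eq X Y M N (z z' : comb (X ++ Y) M N) :
  comb_eq z z' -> cut_eq (split_comb z) (split_comb z').
Proof.
elim: X M z z' => [|p X IH] M /= z z'.
  by move=> zz; apply: rst_step; apply: CutEq => //; apply: comb_refl.
apply: (rst_map (f := @split_comb (p :: X) Y M N)) =>
  {z z'} _ _ [K K' f h r|K f r r' rr] /=.
  apply: rst_sym; apply: rst_trans (glue_cut_eq f (split_lact h r)) _.
  apply: rst_sym; apply: rst_step; apply: CutEq; last exact: comb_refl.
  exact: glue_slide.
by apply: glue_cut_eq; apply: IH.
Qed.

Lemma cat_combK X Y M K N (x : comb X M K) (y : comb Y K N) :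
  cut_eq (split_comb (cat_comb x y)) (Cut x y).
Proof.
elim: X M x => [|p X IH] M /= x.
  by apply: rst_sym; apply: rst_step; rewrite -{1}[x]mcomp1m;
    apply: (CutSlide (idm M : comb [::] _ _)).
by case: x => L [f r] /=; apply: rst_trans (glue_cut_eq f (IH _ r)) _; apply: rst_refl.
Qed.

Lemma split_ract X Y M N N' (z : comb (X ++ Y) M N) (k : hom N N') :
  split_comb (ract z k)
  = Cut (projT2 (split_comb z)).1 (ract (projT2 (split_comb z)).2 k).
Proof. by elim: X M z => [|p X IH] M /= z //; rewrite IH. Qed.

(** * Cells act on combs *)

Lemma cut_ind_eq X Y M N Z P Q (F : cut X Y M N -> comb Z P Q) :
  (forall c d, cut_step c d -> comb_eq (F c) (F d)) ->
  forall c d, cut_eq c d -> comb_eq (F c) (F d).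
Proof.
move=> FS c d; elim=> [{}c {}d /FS //|{}c|{}c {}d _|{}c {}d e _ cd _].
- exact: comb_refl.
- exact: comb_sym.
- exact: comb_trans.
Qed.

(** The transformation of profunctors denoted by a cell.  Arrows of the cell
    are tensored on the right of those of the comb, the corners trade the new
    tensor factor for a letter of the boundary, and a vertical composite acts
    separately on the two parts of a comb cut along its left boundary. *)
Fixpoint sem X A B Y (c : cell X A B Y) : forall M N, comb X M N ->
    comb Y (M ⊗ A) (N ⊗ B) :=
  match c in cell X A B Y return forall M N, comb X M N -> comb Y (M ⊗ A) (N ⊗ B) with
  | Gen _ _ f => fun M N g => tensm g f
  | Scirc A => fun M N g =>
      @glue (A, circ) [::] (M ⊗ A) N (N ⊗ unito) (whisk A g) (idc (esym (tenso1 N)))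
  | Rcirc A => fun M N x =>
      idc (tenso1 M) ;; ((projT2 x).1 : hom M (_ ⊗ A)) ;; whisk A (projT2 x).2
  | Rbullet A => fun M N g =>
      @glue (A, bullet) [::] (M ⊗ unito) (M ⊗ A) (N ⊗ A)
        (whisk A (idc (tenso1 M))) (whisk A g)
  | Sbullet A => fun M N x =>
      ((projT2 x).1 : hom (M ⊗ A) _) ;; (projT2 x).2 ;; idc (esym (tenso1 N))
  | Hid X => fun M N x => lact (idc (tenso1 M)) (ract x (idc (esym (tenso1 N))))
  | Vid A => fun M N g => whisk A g
  | Hcomp _ _ _ A B A' B' a b => fun M N x =>
      lact (idc (tensA M A A')) (ract (sem b (sem a x)) (idc (esym (tensA N B B'))))
  | Vcomp _ _ _ _ _ _ _ a b => fun M N z =>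
      cat_comb (sem a (projT2 (split_comb z)).1) (sem b (projT2 (split_comb z)).2)
  end.

(** The three conditions are needed together: a vertical composite respects
    slides at its cut because the upper cell is natural on the right and the
    lower cell on the left. *)
Definition natural X A B Y (c : cell X A B Y) : Prop :=
  [/\ forall M N (x y : comb X M N), comb_eq x y -> comb_eq (sem c x) (sem c y),
      forall M' M N (h : hom M' M) (x : comb X M N),
        comb_eq (sem c (lact h x)) (lact (whisk A h) (sem c x)) &
      forall M N N' (x : comb X M N) (k : hom N N'),
        comb_eq (sem c (ract x k)) (ract (sem c x) (whisk B k))].

Lemma sem_cut X X' Y Y' A B C (a : cell X A B Y) (b : cell X' B C Y') M N
    (c d : cut X X' M N) : natural a -> natural b -> cut_eq c d ->
  comb_eq (cat_comb (sem a (projT2 c).1) (sem b (projT2 c).2))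
          (cat_comb (sem a (projT2 d).1) (sem b (projT2 d).2)).
Proof.
move=> [ae al ar] [be bl br].
apply: (cut_ind_eq (F := fun c : cut X X' M N =>
  cat_comb (sem a (projT2 c).1) (sem b (projT2 c).2))) =>
    {c d} _ _ [K K' x h y|K x x' y y' xx yy] /=.
  apply: comb_trans (cat_eq (ar _ _ _ _ _) (comb_refl _)) _.
  rewrite cat_bal; apply: cat_eq (comb_refl _) _.
  exact: comb_sym.
by apply: cat_eq; [apply: ae | apply: be].
Qed.

Lemma sem_natural X A B Y (c : cell X A B Y) : natural c.
Proof.
elim: c => {X A B Y}.
- move=> A B f; split=> [M N x y /= -> //|M' M N h x /=|M N N' x k /=].
    exact: tensm_whiskl.
  exact: tensm_whiskr.
- move=> A; split=> [M N x y /= -> //|M' M N h x|M N N' x k].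
  + exact: rst_refl.
  + by rewrite /= whisk_comp; apply: rst_refl.
  + rewrite /= whisk_comp -idc_whisk1.
    exact: (@glue_slide (A, circ) [::]).
- move=> A; split.
  + move=> M N; apply: rst_eq => _ _ [K K' f h r|K f r r' rr] /=.
      by rewrite whisk_comp !mcompA.
    by rewrite rr.
  + by move=> M' M N h [K [f r]] /=; rewrite !mcompA whisk1_idc.
  + by move=> M N N' [K [f r]] k /=; rewrite whisk_comp !mcompA.
- move=> A; split=> [M N x y /= -> //|M' M N h x|M N N' x k].
  + exact: rst_refl.
  + rewrite /= -[_ ;; whisk A (idc _)]whisk_comp whisk1_idc !whisk_comp; apply: rst_sym.
    exact: (@glue_slide (A, bullet) [::]).
  + by rewrite /= whisk_comp; apply: rst_refl.
- move=> A; split.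
  + move=> M N; apply: rst_eq => _ _ [K K' f h r|K f r r' rr] /=.
      by rewrite !mcompA.
    by rewrite rr.
  + by move=> M' M N h [K [f r]] /=; rewrite !mcompA.
  + by move=> M N N' [K [f r]] k /=; rewrite -!mcompA idc_whisk1.
- move=> X; split=> [M N x y xy|M' M N h x|M N N' x k] /=.
  + by apply: lact_eq; apply: ract_eq.
  + by rewrite -lract -!lact_comp whisk1_idc; apply: comb_refl.
  + by rewrite -!lract -!ract_comp idc_whisk1; apply: comb_refl.
- move=> A; split=> [M N x y /= -> //|M' M N h x /=|M N N' x k /=];
    exact: whisk_comp.
- move=> X Y Z A B A' B' a [ae al ar] b [be bl br].
  split=> [M N x y xy|M' M N h x|M N N' x k] /=.
  + by apply/lact_eq/ract_eq/be/ae.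
  + rewrite -!lact_comp whiskA_idc lact_comp; apply: lact_eq.
    rewrite lract; apply: ract_eq.
    by apply: comb_trans (be _ _ _ _ (al _ _ _ _ _)) _; apply: bl.
  + rewrite -lract -ract_comp -idc_whiskA ract_comp; apply/lact_eq/ract_eq.
    by apply: comb_trans (be _ _ _ _ (ar _ _ _ _ _)) _; apply: br.
- move=> X X' Y Y' A B C a na b nb.
  split=> [M N x y xy|M' M N h x|M N N' x k] /=.
  + by apply: sem_cut => //; apply: split_eq.
  + apply: comb_trans (sem_cut na nb (split_lact h x)) _ => /=.
    rewrite -cat_lact; apply: cat_eq (comb_refl _).
    by case: na => _ al _; apply: al.
  + rewrite split_ract /= -cat_ract; apply: cat_eq (comb_refl _) _.
    by case: nb => _ _ br; apply: br.
Qed.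

Lemma sem_eq X A B Y (c : cell X A B Y) M N (x y : comb X M N) :
  comb_eq x y -> comb_eq (sem c x) (sem c y).
Proof. by case: (sem_natural c) => ce _ _; apply: ce. Qed.

Lemma sem_ract X A B Y (c : cell X A B Y) M N N' (x : comb X M N) (k : hom N N') :
  comb_eq (sem c (ract x k)) (ract (sem c x) (whisk B k)).
Proof. by case: (sem_natural c) => _ _; apply. Qed.

Lemma sem_cat X X' Y Y' A B C (a : cell X A B Y) (b : cell X' B C Y') M K N
    (x : comb X M K) (y : comb X' K N) :
  comb_eq (sem (Vcomp a b) (cat_comb x y)) (cat_comb (sem a x) (sem b y)).
Proof. exact: sem_cut (sem_natural a) (sem_natural b) (cat_combK x y). Qed.

(** * Comparing combs with different boundaries *)

(** Equivalence of combs whose boundaries are equal but not convertible, in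
    the manner of heterogeneous equality. *)
Inductive sim X M N (x : comb X M N) :
    forall X' M' N', comb X' M' N' -> Prop :=
| Sim y : comb_eq x y -> sim x y.

Definition comb_cast X X' M M' N N' (eX : X = X') (eM : M = M') (eN : N = N')
    (x : comb X M N) : comb X' M' N' :=
  match eX in _ = X', eM in _ = M', eN in _ = N' return comb X' M' N' with
  | erefl, erefl, erefl => x
  end.

Lemma sim_inv X M N (x : comb X M N) X' M' N' (y : comb X' M' N') : sim x y ->
  exists (eX : X = X') (eM : M = M') (eN : N = N'), comb_eq (comb_cast eX eM eN x) y.
Proof. by case=> z xz; exists erefl, erefl, erefl. Qed.

(** At convertible boundaries nothing is lost, by uniqueness of identity
    proofs. *)
Lemma sim_comb_eq X M N (x y : comb X M N) : sim x y -> comb_eq x y.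
Proof.
case/sim_inv=> eX [eM [eN]].
by rewrite (UIP_refl _ _ eX) (UIP_refl _ _ eM) (UIP_refl _ _ eN).
Qed.

Lemma sim_refl X M N (x : comb X M N) : sim x x.
Proof. by constructor; apply: comb_refl. Qed.

Lemma sim_sym X M N (x : comb X M N) X' M' N' (y : comb X' M' N') :
  sim x y -> sim y x.
Proof. by case=> z xz; constructor; apply: comb_sym. Qed.

Lemma sim_trans X M N (x : comb X M N) X' M' N' (y : comb X' M' N')
    X'' M'' N'' (z : comb X'' M'' N'') : sim x y -> sim y z -> sim x z.
Proof.
move=> xy [w] yw; case: xy w yw => v xv w vw.
by constructor; apply: comb_trans vw.
Qed.

Lemma sim_sem X A B Y (c : cell X A B Y) M N (x : comb X M N) M' N' (y : comb X M' N') :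
  sim x y -> sim (sem c x) (sem c y).
Proof.
case/sim_inv=> eX [eM [eN]]; rewrite (UIP_refl _ _ eX).
case: _ / eM y => y; case: _ / eN y => y xy.
by constructor; apply: sem_eq.
Qed.

Lemma sim_cat X Y M K N (x : comb X M K) (y : comb Y K N)
    X' Y' M' K' N' (x' : comb X' M' K') (y' : comb Y' K' N') :
  sim x x' -> sim y y' -> sim (cat_comb x y) (cat_comb x' y').
Proof.
move=> xx; case: xx y' => {X' M' K'} {}x' xx y' /sim_inv [eY [eM [eN]]].
rewrite (UIP_refl _ _ eM).
case: _ / eY y' => y'; case: _ / eN y' => y' yy.
by constructor; apply: cat_eq.
Qed.

Lemma sim_lact_idc X M' M N (e : M' = M) (x : comb X M N) : sim (lact (idc e) x) x.
Proof. by case: _ / e x => x; rewrite lact_id; apply: sim_refl. Qed.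

Lemma sim_ract_idc X M N N' (e : N = N') (x : comb X M N) : sim (ract x (idc e)) x.
Proof. by case: _ / e; rewrite ract_id; apply: sim_refl. Qed.

Lemma sim_arr M N M' N' (f : hom M N) (g : hom M' N') :
  arr f = arr g -> @sim [::] M N f [::] M' N' g.
Proof.
move=> fg; have eM : M = M' := f_equal (@projT1 _ _) fg.
have eN : N = N' := f_equal (fun x : arrow _ => projT1 (projT2 x)) fg.
by subst; rewrite (arr_inj fg); apply: sim_refl.
Qed.

Lemma sim_glue p X M K N (f : strand p M K) (x : comb X K N) X' N' (x' : comb X' K N') :
  sim x x' -> sim (glue f x) (glue f x').
Proof.
case/sim_inv=> eX [eK [eN]]; rewrite (UIP_refl _ _ eK); subst => xx.
by constructor; apply: glue_eq.
Qed.

Lemma cat_combA X Y Z M K L N (x : comb X M K) (y : comb Y K L) (z : comb Z L N) :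
  sim (cat_comb x (cat_comb y z)) (cat_comb (cat_comb x y) z).
Proof.
elim: X M x => [|p X IH] M /= x; first by rewrite cat_lact; apply: sim_refl.
exact: sim_glue (IH _ _).
Qed.

Lemma cat_comb_nil X M K N (x : comb X M K) (k : hom K N) :
  sim (cat_comb x (k : comb [::] K N)) (ract x k).
Proof.
elim: X M x => [|p X IH] M /= x; first exact: sim_refl.
exact: sim_glue (IH _ _).
Qed.

Lemma sem_Hcomp X Y Z A B A' B' (a : cell X A B Y) (b : cell Y A' B' Z) M N (x :
  comb X M N) :
  sim (sem (Hcomp a b) x) (sem b (sem a x)).
Proof. by apply: sim_trans (sim_lact_idc _ _) _; apply: sim_ract_idc. Qed.

Lemma sem_Hid X M N (x : comb X M N) : sim (sem (Hid X) x) x.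
Proof. by apply: sim_trans (sim_lact_idc _ _) _; apply: sim_ract_idc. Qed.

(** * The equations between cells hold *)

Definition sound X A B Y X' A' B' Y' (a : cell X A B Y) (a' : cell X' A' B' Y') : Prop :=
  forall M N (x : comb X M N) M' N' (x' : comb X' M' N'),
    sim x x' -> sim (sem a x) (sem a' x').

(** Since actions respect [sim], a single comparable input suffices. *)
Lemma soundI X A B Y X' A' B' Y' (a : cell X A B Y) (a' : cell X' A' B' Y') :
  (forall M N (x : comb X M N), exists2 x' : comb X' M N,
     sim x x' & sim (sem a x) (sem a' x')) -> sound a a'.
Proof.
move=> aa M N x M' N' y xy; have [x' xx' sxx'] := aa M N x.
by apply: sim_trans sxx' (sim_sem _ _); apply: sim_trans xy; apply: sim_sym.
Qed.

Lemma soundI_eq X A B Y A' B' Y' (a : cell X A B Y) (a' : cell X A' B' Y') :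
  (forall M N (x : comb X M N), sim (sem a x) (sem a' x)) -> sound a a'.
Proof. by move=> aa; apply: soundI => M N x; exists x; [apply: sim_refl | apply: aa]. Qed.

(** Horizontal composition acts by composition of functions and vertical
    composition by concatenation of combs, so the axioms of a double category
    are properties of these two operations; for the vertical ones the input is
    written as a concatenation first.  A yanking equation compares a comb with
    itself after a corner and its partner have moved A away and back: the
    horizontal ones hold strictly, the vertical ones up to one slide. *)
Lemma soundness X A B Y X' A' B' Y' (a : cell X A B Y) (a' : cell X' A' B' Y') :
  cell_eq a a' -> sound a a'.
Proof.
elim=> {X A B Y X' A' B' Y' a a'}.
- by move=> X A B Y a M N x M' N' x' xx; apply: sim_sem.
- move=> X A B Y X' A' B' Y' a a' _ aa M N x M' N' x' xx.
  by apply/sim_sym/aa/sim_sym.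
- move=> X A B Y X' A' B' Y' X'' A'' B'' Y'' a a' a'' e1 aa e2 aa'.
  have [eX _ _ _] := cell_eq_boundary e1; case: _ / eX in a' e1 aa e2 aa' *.
  by move=> M N x M' N' x' xx;
    apply: sim_trans (aa _ _ _ _ _ _ (sim_refl x)) (aa' _ _ _ _ _ _ xx).
- move=> X Y Z A B C D X' Y' Z' A' B' C' D' a b a' b' _ aa _ bb M N x M' N' x' xx.
  apply: sim_trans (sem_Hcomp _ _ _) (sim_trans _ (sim_sym (sem_Hcomp _ _ _))).
  by apply/bb/aa.
- move=> X Y Z W A B C X' Y' Z' W' A' B' C' a b a' b' e1 aa e2 bb.
  have [eX _ _ _] := cell_eq_boundary e1; have [eZ _ _ _] := cell_eq_boundary e2.
  subst; apply: soundI_eq => M N z.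
  have [K [x [y ->]]] := split_combP z.
  apply: sim_trans (Sim (sem_cat _ _ _ _))
    (sim_trans _ (sim_sym (Sim (sem_cat _ _ _ _)))).
  by apply: sim_cat; [apply: aa | apply: bb]; apply: sim_refl.
- move=> X Y Z W A B A' B' A'' B'' a b c; apply: soundI_eq => M N x.
  apply: sim_trans (sem_Hcomp _ _ _) (sim_trans (sem_Hcomp _ _ _) (sim_sym _)).
  by apply: sim_trans (sem_Hcomp _ _ _) (sim_sem _ _); apply: sem_Hcomp.
- move=> X A B Y a; apply: soundI_eq => M N x.
  by apply: sim_trans (sem_Hcomp _ _ _) (sim_sem _ _); apply: sem_Hid.
- move=> X A B Y a; apply: soundI_eq => M N x.
  by apply: sim_trans (sem_Hcomp _ _ _) _; apply: sem_Hid.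
- move=> X Y X' Y' X'' Y'' A B C D a b c; apply: soundI => M N z.
  have [K [x [y {z}->]]] := split_combP z; have [L [{}y [z ->]]] := split_combP y.
  exists (cat_comb (cat_comb x y) z); first exact: cat_combA.
  apply: sim_trans (Sim (sem_cat _ _ _ _)) _.
  apply: sim_trans (sim_cat (sim_refl _) (Sim (sem_cat _ _ _ _))) _.
  apply: sim_trans (cat_combA _ _ _) (sim_sym _).
  apply: sim_trans (Sim (sem_cat _ _ _ _)) _.
  exact: sim_cat (Sim (sem_cat _ _ _ _)) (sim_refl _).
- move=> X A B Y a; apply: soundI_eq => M N x /=.
  by rewrite whisk_id lact_id; apply: sim_refl.
- move=> X A B Y a; apply: soundI => M N z.
  have [K [x [k {z}->]]] := split_combP z.
  exists (ract x k); first exact: cat_comb_nil.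
  apply: sim_trans (Sim (sem_cat _ _ _ _)) (sim_trans (cat_comb_nil _ _) _).
  by apply: sim_sym; constructor; apply: sem_ract.
- move=> X Y; apply: soundI_eq => M N z.
  have [K [x [y ->]]] := split_combP z.
  apply: sim_trans (sem_Hid _) (sim_sym _).
  apply: sim_trans (Sim (sem_cat _ _ _ _)) _.
  by apply: sim_cat; apply: sem_Hid.
- move=> A B; apply: soundI_eq => M N x.
  apply: sim_trans _ (sim_sym (sem_Hcomp _ _ _)) => /=.
  by apply: sim_arr; apply: arr_whiskA.
- apply: soundI_eq => M N x; apply: sim_trans (sem_Hid _) _ => /=.
  by apply: sim_arr; rewrite arr_whisk1.
- move=> X Y Z X' Y' Z' A B C A' B' C' a b c d; apply: soundI_eq => M N z.
  have [K [x [y ->]]] := split_combP z.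
  apply: sim_trans (sem_Hcomp _ _ _) _.
  apply: sim_trans (sim_sem _ (Sim (sem_cat _ _ _ _))) _.
  apply: sim_trans (Sim (sem_cat _ _ _ _)) (sim_sym _).
  apply: sim_trans (Sim (sem_cat _ _ _ _)) _.
  by apply: sim_cat; apply: sem_Hcomp.
- move=> A B C f g; apply: soundI_eq => M N x /=.
  by rewrite -tensm_comp mcomp1m; apply: sim_refl.
- by move=> A; apply: soundI_eq => M N x; apply: sim_refl.
- move=> A B A' B' f g; apply: soundI_eq => M N x.
  apply: sim_trans _ (sim_sym (sem_Hcomp _ _ _)) => /=.
  by apply: sim_arr; apply: arr_tensmA.
- move=> A; apply: soundI_eq => M N x; apply: sim_trans (sem_Hcomp _ _ _) _ => /=.
  apply: sim_arr; rewrite -mcompA arr_idcl -whisk_comp.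
  by apply: arr_whisk; rewrite arr_idcr.
- move=> A; apply: soundI_eq => M N [K [f r]].
  apply: sim_trans _ (sim_sym (sem_Hid _)).
  (* The arrow r that ends the comb is carried by the lower corner and slides
     back down. *)
  apply: (@sim_trans _ _ _ _ [:: (A, circ)] _ _
    (lact (idc (tenso1 M)) (@glue (A, circ) [::] M K _ f (r ;; idc (esym (tenso1 N)))))).
    constructor; rewrite /= !whisk_id mcompm1.
    exact: (@glue_slide (A, circ) [::]).
  apply: sim_trans (sim_lact_idc _ _) _.
  exact: (@sim_ract_idc [:: (A, circ)] _ _ _ _ (@glue (A, circ) [::] M K N f r)).
- move=> A; apply: soundI_eq => M N x; apply: sim_trans (sem_Hcomp _ _ _) _ => /=.
  by apply: sim_arr; rewrite arr_idcr -whisk_comp; apply: arr_whisk; rewrite arr_idcl.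
- move=> A; apply: soundI_eq => M N [K [f r]].
  apply: sim_trans _ (sim_sym (sem_Hid _)).
  (* The upper corner leaves an identity in the strand, and f slides up from
     the end of the comb. *)
  apply: (@sim_trans _ _ _ _ [:: (A, bullet)] _ _
    (lact (idc (tenso1 M)) (@glue (A,
      bullet) [::] M K _ f (r ;; idc (esym (tenso1 N)))))).
    constructor; rewrite /= whisk_id mcomp1m -mcompA; apply: rst_sym.
    exact: (@glue_slide (A, bullet) [::]).
  apply: sim_trans (sim_lact_idc _ _) _.
  exact: (@sim_ract_idc [:: (A, bullet)] _ _ _ _ (@glue (A, bullet) [::] M K N f r)).
Qed.

(** * Combs drawn as cells *)

Local Notation "a ≡ b" := (cell_eq a b) (at level 70).

Lemma Gen_arr M N M' N' (f : hom M N) (g : hom M' N') : arr f = arr g -> Gen f ≡ Gen g.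
Proof.
move=> fg; have eM : M = M' := f_equal (@projT1 _ _) fg.
have eN : N = N' := f_equal (fun x : arrow _ => projT1 (projT2 x)) fg.
by subst; rewrite (arr_inj fg); apply: ceq_refl.
Qed.

Lemma Gen_Vid M N K (f : hom M N) : arr f = arr (idm K) -> Gen f ≡ Vid K.
Proof. by move/Gen_arr => fK; apply: ceq_trans fK (ceq_Gen_id _). Qed.

Lemma Vcomp_eql X Y Z W A B C X' Y' A' (a : cell X A B Y) (a' : cell X' A' B Y') (b :
  cell Z B C W) :
  a ≡ a' -> Vcomp a b ≡ Vcomp a' b.
Proof. by move=> aa; apply: ceq_Vcomp aa (ceq_refl _). Qed.

Lemma Vcomp_eqr X Y Z W A B C Z' W' C' (a : cell X A B Y) (b : cell Z B C W) (b' :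
  cell Z' B C' W') :
  b ≡ b' -> Vcomp a b ≡ Vcomp a b'.
Proof. by move=> bb; apply: ceq_Vcomp (ceq_refl _) bb. Qed.

Lemma Vcomp_idl X Y A B A' (u : cell [::] A' A [::]) (a : cell X A B Y) :
  u ≡ Vid A -> Vcomp u a ≡ a.
Proof. by move=> uA; apply: ceq_trans (Vcomp_eql _ uA) (ceq_Vcomp1c _). Qed.

Lemma Vcomp_idr X Y A B B' (a : cell X A B Y) (u : cell [::] B B' [::]) :
  u ≡ Vid B -> Vcomp a u ≡ a.
Proof. by move=> uB; apply: ceq_trans (Vcomp_eqr _ uB) (ceq_Vcompc1 _). Qed.

Lemma Hcomp_unit X A B (a : cell X A B [::]) : Hcomp a (Vid unito) ≡ a.
Proof.
apply: ceq_trans (ceq_Hcompc1 a); apply: ceq_Hcomp (ceq_refl _) _.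
exact: ceq_sym (ceq_HVid _).
Qed.

Lemma Gen_whisk A M N (f : hom M N) : Gen (whisk A f) ≡ Hcomp (Gen f) (Vid A).
Proof.
apply: ceq_trans (ceq_Gen_tens _ _) _.
by apply: ceq_Hcomp (ceq_refl _) _; apply: ceq_Gen_id.
Qed.

Lemma whisk_cell M N A B Y (f : hom M N) (c : cell [::] A B Y) :
  Vcomp (Gen (whisk A f)) (Hcomp (Vid N) c) ≡ Hcomp (Gen f) c.
Proof.
apply: ceq_trans (Vcomp_eql _ (Gen_whisk _ _)) _.
apply: ceq_trans (ceq_sym (ceq_interchange (Gen f) (Vid N) (Vid A) c)) _.
by apply: ceq_Hcomp; [apply: ceq_Vcompc1 | apply: ceq_Vcomp1c].
Qed.

Lemma cell_whisk M N A B Y (f : hom M N) (c : cell [::] A B Y) :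
  Vcomp (Hcomp (Vid M) c) (Gen (whisk B f)) ≡ Hcomp (Gen f) c.
Proof.
apply: ceq_trans (Vcomp_eqr _ (Gen_whisk _ _)) _.
apply: ceq_trans (ceq_sym (ceq_interchange (Vid M) (Gen f) c (Vid B))) _.
by apply: ceq_Hcomp; [apply: ceq_Vcomp1c | apply: ceq_Vcompc1].
Qed.

(** Interchange lets an arrow on the left pass a cell on its right, because
    the left boundary of the cell is empty. *)
Lemma slide_cell M N A B Y (f : hom M N) (c : cell [::] A B Y) :
  Vcomp (Gen (whisk A f)) (Hcomp (Vid N) c) ≡ Vcomp (Hcomp (Vid M) c) (Gen (whisk B f)).
Proof. by apply: ceq_trans (whisk_cell _ _) (ceq_sym (cell_whisk _ _)). Qed.

(** A strand is drawn as its arrow and a corner cell.  For A° the corner takes A out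
    of the target of the arrow, for A• it adds A to the source; the other edge
    of the corner leaves a unit factor that an identity arrow removes. *)
Definition corner p M K : strand p M K -> cell [::] M K [:: p] :=
  match p return strand p M K -> cell [::] M K [:: p] with
  | (A, circ) => fun f =>
      Vcomp (Gen f) (Vcomp (Hcomp (Vid K) (Scirc A)) (Gen (idc (tenso1 K))))
  | (A, bullet) => fun f =>
      Vcomp (Gen (idc (esym (tenso1 M)))) (Vcomp (Hcomp (Vid M) (Rbullet A)) (Gen f))
  end.

Fixpoint realize X : forall M N, comb X M N -> cell [::] M N X :=
  match X return forall M N, comb X M N -> cell [::] M N X with
  | [::] => fun M N f => Gen f
  | p :: X' => fun M N x => Vcomp (corner (projT2 x).1) (realize (projT2 x).2)
  end.

Lemma corner_strandl p M' M K (h : hom M' M) (f : strand p M K) :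
  corner (strandl h f) ≡ Vcomp (Gen h) (corner f).
Proof.
case: p f => A [] f /=.
  apply: ceq_trans (Vcomp_eql _ (ceq_Gen_comp _ _)) _.
  exact: ceq_sym (ceq_VcompA _ _ _).
set R := fun M => Hcomp (Vid M) (Rbullet A).
apply: ceq_trans (Vcomp_eqr (Gen _) (Vcomp_eqr (R _) (ceq_Gen_comp _ _))) _.
apply: ceq_trans (Vcomp_eqr (Gen _) (ceq_VcompA (R _) (Gen _) (Gen _))) _.
apply: ceq_trans (Vcomp_eqr (Gen _)
  (Vcomp_eql (Gen _) (ceq_sym (slide_cell h (Rbullet A))))) _.
apply: ceq_trans (Vcomp_eqr (Gen _) (ceq_sym (ceq_VcompA (Gen _) (R _) (Gen _)))) _.
apply: ceq_trans (ceq_VcompA (Gen _) (Gen _) (Vcomp (R _) (Gen _))) _.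
apply: ceq_trans _ (ceq_sym (ceq_VcompA (Gen _) (Gen _) (Vcomp (R _) (Gen _)))).
apply: Vcomp_eql; apply: ceq_trans (ceq_sym (ceq_Gen_comp _ _)) _.
by rewrite -idc_whisk1; apply: ceq_Gen_comp.
Qed.

(** The slides of combs become associativity of vertical composition once an
    arrow is allowed to enter the corner from below. *)
Lemma corner_strandr p M K K' (f : strand p M K) (k : hom K K') :
  corner (strandr k f) ≡ Vcomp (corner f) (Gen k).
Proof.
case: p f => A [] f /=; last first.
  set R := Hcomp (Vid M) (Rbullet A).
  apply: ceq_trans (Vcomp_eqr (Gen _) (Vcomp_eqr R (ceq_Gen_comp _ _))) _.
  apply: ceq_trans (Vcomp_eqr (Gen _) (ceq_VcompA R (Gen _) (Gen _))) _.
  exact: ceq_VcompA (Gen _) (Vcomp R (Gen _)) (Gen _).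
set S := fun K => Hcomp (Vid K) (Scirc A).
apply: ceq_trans (Vcomp_eql (Vcomp (S _) (Gen _)) (ceq_Gen_comp _ _)) _.
apply: ceq_trans (ceq_sym (ceq_VcompA (Gen _) (Gen _) (Vcomp (S _) (Gen _)))) _.
apply: ceq_trans (Vcomp_eqr (Gen _) (ceq_VcompA (Gen _) (S _) (Gen _))) _.
apply: ceq_trans (Vcomp_eqr (Gen _) (Vcomp_eql (Gen _) (slide_cell k (Scirc A)))) _.
apply: ceq_trans (Vcomp_eqr (Gen _) (ceq_sym (ceq_VcompA (S _) (Gen _) (Gen _)))) _.
apply: ceq_trans _ (ceq_VcompA (Gen _) (Vcomp (S _) (Gen _)) (Gen k)); apply: Vcomp_eqr.
apply: ceq_trans _ (ceq_VcompA (S _) (Gen _) (Gen k)); apply: Vcomp_eqr.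
apply: ceq_trans (ceq_sym (ceq_Gen_comp _ _)) _.
by rewrite whisk1_idc; apply: ceq_Gen_comp.
Qed.

Lemma realize_lact X M' M N (h : hom M' M) (x : comb X M N) :
  realize (lact h x) ≡ Vcomp (Gen h) (realize x).
Proof.
case: X x => [|p X] /= x; first exact: ceq_Gen_comp.
apply: ceq_trans (Vcomp_eql (realize _) (corner_strandl _ _)) _.
exact: ceq_sym (ceq_VcompA (Gen _) (corner _) (realize _)).
Qed.

Lemma realize_cat X Y M K N (x : comb X M K) (y : comb Y K N) :
  realize (cat_comb x y) ≡ Vcomp (realize x) (realize y).
Proof.
elim: X M x => [|p X IH] M /= x; first exact: realize_lact.
exact: ceq_trans (Vcomp_eqr (corner _) (IH _ _))
  (ceq_VcompA (corner _) (realize _) (realize _)).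
Qed.

Lemma realize_eq X M N (x y : comb X M N) : comb_eq x y -> realize x ≡ realize y.
Proof.
elim: X M x y => [|p X IH] M /= x y; first by move->; apply: ceq_refl.
elim=> {x y} [_ _ [K K' f h r|K f r r' rr]|x|x y _|x y z _ xy _] /=.
- apply: ceq_trans (Vcomp_eql (realize _) (corner_strandr _ _)) _.
  apply: ceq_trans (ceq_sym (ceq_VcompA (corner _) (Gen _) (realize _))) _.
  exact (Vcomp_eqr (corner f) (ceq_sym (realize_lact h r))).
- exact (Vcomp_eqr (corner f) (IH _ _ _ rr)).
- exact: ceq_refl.
- exact: ceq_sym.
- exact: ceq_trans.
Qed.

Lemma realize_sim X M N (x : comb X M N) X' M' N' (y : comb X' M' N') :
  sim x y -> realize x ≡ realize y.
Proof. by case=> z; apply: realize_eq. Qed.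

(** A drawn strand straightens to its arrow when the partner of its corner is
    put on its right: this is the horizontal yanking equation. *)
Lemma corner_Rcirc A M K (f : hom M (K ⊗ A)) :
  Hcomp (corner (f : strand (A, circ) M K)) (Rcirc A) ≡ Gen f.
Proof.
set S := Hcomp (Vid K) (Scirc A).
have RE : Rcirc A ≡ Vcomp (Vid unito) (Vcomp (Rcirc A) (Vid A)).
  exact: ceq_sym (ceq_trans (ceq_Vcomp1c _) (ceq_Vcompc1 _)).
refine (ceq_trans (ceq_Hcomp (ceq_refl _) RE) _).
refine (ceq_trans (ceq_interchange (Gen f) (Vcomp S (Gen _)) (Vid unito)
  (Vcomp (Rcirc A) (Vid A))) _).
refine (ceq_trans (Vcomp_eqr (Hcomp (Gen f) (Vid unito))
  (ceq_interchange S (Gen _) (Rcirc A) (Vid A))) _).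
have SR : Hcomp S (Rcirc A) ≡ Vid (K ⊗ unito ⊗ A).
  refine (ceq_trans (ceq_sym (ceq_HcompA (Vid K) (Scirc A) (Rcirc A))) _).
  refine (ceq_trans (ceq_Hcomp (ceq_refl _) (ceq_circ_h A)) _).
  apply: ceq_trans (ceq_sym (ceq_Vid _ _)) _; rewrite tenso1; exact: ceq_refl.
refine (ceq_trans (ceq_Vcomp (Hcomp_unit (Gen f)) (b' := Vid (K ⊗ A)) _) (ceq_Vcompc1 _)).
refine (ceq_trans (Vcomp_eql (Hcomp (Gen _) (Vid A)) SR) _).
refine (ceq_trans (ceq_Vcomp1c _) (ceq_trans (ceq_sym (Gen_whisk A _)) _)).
by apply: Gen_Vid; rewrite -whisk_id; apply: arr_whisk; rewrite arr_idc tenso1.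
Qed.

Lemma corner_Sbullet A M K (f : hom (M ⊗ A) K) :
  Hcomp (corner (f : strand (A, bullet) M K)) (Sbullet A) ≡ Gen f.
Proof.
set R := Hcomp (Vid M) (Rbullet A).
have SE : Sbullet A ≡ Vcomp (Vid A) (Vcomp (Sbullet A) (Vid unito)).
  exact: ceq_sym (ceq_trans (ceq_Vcomp1c _) (ceq_Vcompc1 _)).
refine (ceq_trans (ceq_Hcomp (ceq_refl _) SE) _).
refine (ceq_trans (ceq_interchange (Gen _) (Vcomp R (Gen f)) (Vid A)
  (Vcomp (Sbullet A) (Vid unito))) _).
refine (ceq_trans (Vcomp_eqr (Hcomp (Gen _) (Vid A))
  (ceq_interchange R (Gen f) (Sbullet A) (Vid unito))) _).
have RS : Hcomp R (Sbullet A) ≡ Vid (M ⊗ A).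
  refine (ceq_trans (ceq_sym (ceq_HcompA (Vid M) (Rbullet A) (Sbullet A))) _).
  refine (ceq_trans (ceq_Hcomp (ceq_refl _) (ceq_bullet_h A)) _).
  exact: ceq_sym (ceq_Vid _ _).
refine (ceq_trans (ceq_Vcomp (a' := Vid (M ⊗ A)) (b' := Gen f) _ _) (ceq_Vcomp1c _)).
  apply: ceq_trans (ceq_sym (Gen_whisk A _)) _.
  apply: Gen_Vid; rewrite -whisk_id; apply: arr_whisk; exact: arr_idc.
refine (ceq_trans (ceq_Vcomp RS (Hcomp_unit (Gen f))) (ceq_Vcomp1c _)).
Qed.

(** Completeness of the action: whatever is drawn to the right of a drawn comb
    can be absorbed in it.  Generating cells are absorbed by yanking or by
    passing an arrow through a corner, and composites one factor at a time. *)
Lemma realize_sem X A B Y (a : cell X A B Y) M N (x : comb X M N) :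
  Hcomp (realize x) a ≡ realize (sem a x).
Proof.
elim: a M N x => {X A B Y}.
- by move=> A B f M N g; apply: ceq_sym (ceq_Gen_tens _ _).
- move=> A M N g /=.
  refine (ceq_trans (ceq_sym (whisk_cell g (Scirc A))) _).
  set S := Hcomp (Vid N) (Scirc A).
  refine (ceq_trans _ (ceq_VcompA (Gen _) (Vcomp S (Gen _)) (Gen _))).
  refine (Vcomp_eqr (Gen _) _).
  refine (ceq_trans _ (ceq_VcompA S (Gen _) (Gen _))).
  apply: ceq_sym; apply: Vcomp_idr; apply: ceq_trans (ceq_sym (ceq_Gen_comp _ _)) _.
  by apply: Gen_Vid; rewrite arr_idcr arr_idc tenso1.
- move=> A M N [K [f r]] /=.
  have RE : Rcirc A ≡ Vcomp (Rcirc A) (Vid A) by apply: ceq_sym (ceq_Vcompc1 _).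
  refine (ceq_trans (ceq_Hcomp (ceq_refl _) RE) _).
  refine (ceq_trans (ceq_interchange (corner f) (Gen r) (Rcirc A) (Vid A)) _).
  refine (ceq_trans (ceq_Vcomp (corner_Rcirc f) (ceq_sym (Gen_whisk A r))) _).
  refine (ceq_trans (ceq_sym (ceq_Gen_comp _ _)) _).
  by apply: Gen_arr; rewrite -mcompA arr_idcl.
- move=> A M N g /=.
  refine (ceq_trans (ceq_sym (cell_whisk g (Rbullet A))) _).
  set R := fun M => Hcomp (Vid M) (Rbullet A).
  apply: ceq_sym.
  refine (Vcomp_eql (a := Vcomp (Gen _) (Vcomp (R _) (Gen _))) (a' :=
    R M) (Gen (whisk A g)) _).
  refine (ceq_trans (Vcomp_eqr (Gen _) (ceq_sym (slide_cell _ (Rbullet A)))) _).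
  refine (ceq_trans (ceq_VcompA (Gen _) (Gen _) (R M)) _).
  apply: Vcomp_idl; apply: ceq_trans (ceq_sym (ceq_Gen_comp _ _)) _.
  by apply: Gen_Vid; rewrite arr_idcl arr_whisk1 arr_idc tenso1.
- move=> A M N [K [f r]] /=.
  have SE : Sbullet A ≡ Vcomp (Sbullet A) (Vid unito) by apply: ceq_sym (ceq_Vcompc1 _).
  refine (ceq_trans (ceq_Hcomp (ceq_refl _) SE) _).
  refine (ceq_trans (ceq_interchange (corner f) (Gen r) (Sbullet A) (Vid unito)) _).
  refine (ceq_trans (ceq_Vcomp (corner_Sbullet f) (Hcomp_unit (Gen r))) _).
  refine (ceq_trans (ceq_sym (ceq_Gen_comp _ _)) _).
  by apply: Gen_arr; rewrite arr_idcr.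
- move=> X M N x; apply: ceq_trans (ceq_Hcompc1 _) _.
  by apply: realize_sim; apply: sim_sym; apply: sem_Hid.
- by move=> A M N g; apply: ceq_sym (Gen_whisk _ _).
- move=> X Y Z A B A' B' a IHa b IHb M N x.
  refine (ceq_trans (ceq_HcompA _ _ _) _).
  refine (ceq_trans (ceq_Hcomp (IHa _ _ _) (ceq_refl _)) _).
  refine (ceq_trans (IHb _ _ _) _).
  by apply: realize_sim; apply: sim_sym; apply: sem_Hcomp.
- move=> X X' Y Y' A B C a IHa b IHb M N z.
  have [K [x [y ->]]] := split_combP z.
  refine (ceq_trans (ceq_Hcomp (realize_cat _ _) (ceq_refl _)) _).
  refine (ceq_trans (ceq_interchange _ _ _ _) _).
  refine (ceq_trans (ceq_Vcomp (IHa _ _ _) (IHb _ _ _)) _).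
  refine (ceq_trans (ceq_sym (realize_cat _ _)) _).
  by apply: realize_sim; apply: sim_sym; constructor; apply: sem_cat.
Qed.

Lemma sem_Gen_unit M N (f : hom M N) :
  @sim [::] _ _ (sem (Gen f) (idm unito : comb [::] _ _)) [::] M N f.
Proof. by apply: sim_arr; apply: arr_tensm1m. Qed.

Lemma sem_Vid_Hcomp M A B Y (c : cell [::] A B Y) :
  sim (sem (Hcomp (Vid M) c) (idm unito : comb [::] _ _)) (sem c (idm M : comb [::] _ _)).
Proof.
apply: sim_trans (sem_Hcomp _ _ _) (sim_sem _ _) => /=.
by apply: sim_arr; rewrite whisk_id tens1o.
Qed.

Lemma esym_idcK M N (e : M = N) : idc (esym e) ;; idc e = idm N.
Proof. by case: _ / e; apply: mcomp1m. Qed.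

Lemma sem_corner p M K (f : strand p M K) :
  sim (sem (corner f) (idm unito : comb [::] _ _)) (@glue p [::] M K K f (idm K)).
Proof.
case: p f => A [] f.
  refine (sim_trans (sim_cat (sem_Gen_unit f)
    (sim_cat (sem_Vid_Hcomp K (Scirc A)) (sem_Gen_unit (idc (tenso1 K))))) _).
  by rewrite /= esym_idcK whisk_id mcompm1; apply: sim_refl.
refine (sim_trans (sim_cat (sem_Gen_unit (idc (esym (tenso1 M))))
  (sim_cat (sem_Vid_Hcomp M (Rbullet A)) (sem_Gen_unit f))) _).
rewrite /= -whisk_comp esym_idcK !whisk_id mcomp1m; constructor; apply: comb_sym.
have := @glue_slide (A, bullet) [::] M (M ⊗ A) K K (idm (M ⊗ A)) f (idm K).
by rewrite /= mcomp1m mcompm1.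
Qed.

(** A drawn comb acts on the identity of the unit by returning the comb: its
    corners do so, and the action turns vertical composition into
    concatenation. *)
Lemma sem_realize X M N (x : comb X M N) :
  sim (sem (realize x) (idm unito : comb [::] _ _)) x.
Proof.
elim: X M x => [|p X IH] M x; first exact: sem_Gen_unit.
case: x => K [f r].
refine (sim_trans (sim_cat (sem_corner f) (IH _ r)) _).
by rewrite /= lact_id; apply: sim_refl.
Qed.

(** Drawing the identity of I to the left of a cell changes nothing, and by
    [realize_sem] the result is the drawing of the action on that identity:
    the action determines the cell. *)
Lemma cell_eq_sem X (a b : cell [::] unito unito X) :
  cell_eq a b <-> sim (sem a (idm unito : comb [::] _ _))
    (sem b (idm unito : comb [::] _ _)).
Proof.
split=> [/soundness|/realize_sim ab]; first by apply; apply: sim_refl.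
have H c : Hcomp (realize (idm unito : comb [::] _ _)) c ≡ (c : cell [::] unito unito X).
  apply: ceq_trans (ceq_Hcomp _ (ceq_refl _)) (ceq_Hcomp1c _).
  exact: ceq_trans (ceq_Gen_id _) (ceq_sym (ceq_HVid _)).
apply: ceq_trans (ceq_sym (H a)) (ceq_trans (realize_sem _ _) _).
apply: ceq_trans ab _.
exact: ceq_trans (ceq_sym (realize_sem _ _)) (H b).
Qed.

End Tensor.

(** * Alternating words *)

Section Links.
Variable AA : strictMonoidal.
Implicit Types P Q K : AA.

(** In a pair A•, B° the first strand can be normalised to an identity, leaving
    the arrow P ⊗ A -> K ⊗ B as the only datum. *)
Definition tooth A B P K X N (f : hom (P ⊗ A) (K ⊗ B)) (r : comb X K N) :
    comb [:: (A, bullet), (B, circ) & X] P N :=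
  @glue AA (A, bullet) ((B, circ) :: X) P (P ⊗ A) N (idm (P ⊗ A))
    (@glue AA (B, circ) X (P ⊗ A) K N f r).

Lemma tooth_slide A B P K K' X N (f : hom (P ⊗ A) (K ⊗ B)) (k : hom K K') (r :
  comb X K' N) :
  comb_eq (tooth (f ;; whisk B k) r) (tooth f (lact k r)).
Proof. by apply: glue_eq; apply: (@glue_slide AA (B, circ)). Qed.

Lemma tooth_eq A B P K X N (f : hom (P ⊗ A) (K ⊗ B)) (r r' : comb X K N) :
  comb_eq r r' -> comb_eq (tooth f r) (tooth f r').
Proof. by move=> rr; apply/glue_eq/glue_eq. Qed.

Lemma lact_tooth A B P P' K X N (h : hom P P') (f : hom (P' ⊗ A) (K ⊗ B)) (r :
  comb X K N) :
  comb_eq (tooth (whisk A h ;; f) r) (lact h (tooth f r)).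
Proof.
have := @glue_slide AA (A, bullet) ((B, circ) :: X) P _ _ N (idm (P ⊗ A)) (whisk A h)
  (@glue AA (B, circ) X (P' ⊗ A) K N f r).
by rewrite /= mcomp1m mcompm1; apply: rst_sym.
Qed.

(** The co-Yoneda lemma: the arrow of the strand A• slides into the strand
    B°. *)
Lemma glue_tooth A B P L K X N (f : hom (P ⊗ A) L) (g : hom L (K ⊗ B)) (r : comb X K N) :
  comb_eq (@glue AA (A, bullet) ((B, circ) :: X) P L N f (@glue AA (B, circ) X L K N g r))
          (tooth (f ;; g) r).
Proof.
have := @glue_slide AA (A, bullet) ((B, circ) :: X) P _ _ N (idm (P ⊗ A)) f
  (@glue AA (B, circ) X L K N g r).
by rewrite /= mcomp1m.
Qed.

Definition rest n (F : 'I_n.+1 -> AA) : 'I_n -> AA := fun i => F (lift ord0 i).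

Fixpoint word n : ('I_n -> AA) -> ('I_n -> AA) -> vmon AA :=
  match n return ('I_n -> AA) -> ('I_n -> AA) -> vmon AA with
  | 0 => fun A B => [::]
  | n'.+1 => fun A B => [:: (A ord0, bullet), (B ord0, circ) &
      word (rest A) (rest B)]
  end.

Lemma big_word n (A B : 'I_n -> AA) :
  \big[cat/[::]]_(i < n) [:: (A i, bullet); (B i, circ)] = word A B.
Proof.
elim: n A B => [|n IH] A B /=; first exact: big_ord0.
by rewrite big_ord_recl -IH.
Qed.

(** The tuples of the coend, by recursion instead of indexed by ordinals and
    with arbitrary objects P and Q at the ends, since the remaining links start
    at the first inner object. *)
Fixpoint links m : ('I_m.+1 -> AA) -> ('I_m.+1 -> AA) -> AA -> AA -> Type :=
  match m return ('I_m.+1 -> AA) -> ('I_m.+1 -> AA) -> AA -> AA -> Type with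
  | 0 => fun A B P Q => hom (P ⊗ A ord0) (Q ⊗ B ord0)
  | m'.+1 => fun A B P Q => {K : AA & hom (P ⊗ A ord0) (K ⊗ B ord0) *
      links (rest A) (rest B) K Q}%type
  end.

(** One step of the coend, with all the inner objects moved at once.  Both
    tuples share arrows x: in c these are preceded by h at the left end and by
    arrows k at the inner objects, in c' they are followed by the arrows k.
    Only h = 1 occurs in the coend, but the remaining links see k as their h. *)
Fixpoint shift m : forall (A B : 'I_m.+1 -> AA) P P' Q, hom P P' ->
    links A B P Q -> links A B P' Q -> Prop :=
  match m return forall (A B : 'I_m.+1 -> AA) P P' Q, hom P P' ->
    links A B P Q -> links A B P' Q -> Prop with
  | 0 => fun A B P P' Q h c c' => c = whisk (A ord0) h ;; c'
  | m'.+1 => fun A B P P' Q h c c' =>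
      exists (x : hom (P' ⊗ A ord0) (projT1 c ⊗ B ord0)) (k : hom (projT1 c) (projT1 c')),
      [/\ (projT2 c).1 = whisk (A ord0) h ;; x, (projT2 c').1 = x ;; whisk (B ord0) k &
          shift k (projT2 c).2 (projT2 c').2]
  end.

Local Notation links_eq := (rst (shift (idm _))).

Lemma shift_refl m (A B : 'I_m.+1 -> AA) P Q (c : links A B P Q) : shift (idm P) c c.
Proof.
elim: m A B P Q c => [|m IH] A B P Q c /=; first by rewrite whisk_id mcomp1m.
by exists (projT2 c).1, (idm _); rewrite !whisk_id mcomp1m mcompm1.
Qed.

Fixpoint comb_of m : forall (A B : 'I_m.+1 -> AA) P Q, links A B P Q ->
    comb (word A B) P Q :=
  match m return forall (A B : 'I_m.+1 -> AA) P Q, links A B P Q ->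
    comb (word A B) P Q with
  | 0 => fun A B P Q f => tooth f (idm Q : comb [::] Q Q)
  | m'.+1 => fun A B P Q c => tooth (projT2 c).1 (comb_of (projT2 c).2)
  end.

(** Two uses of the co-Yoneda lemma: the object inside each pair A•, B°
    disappears by composition, and the object after the last pair because the
    arrow that ends the comb is absorbed in the last link. *)
Fixpoint fuse m : forall (A B : 'I_m.+1 -> AA) P Q, comb (word A B) P Q ->
    links A B P Q :=
  match m return forall (A B : 'I_m.+1 -> AA) P Q, comb (word A B) P Q ->
    links A B P Q with
  | 0 => fun A B P Q z =>
      ((projT2 z).1 : hom (P ⊗ A ord0) _) ;;
      ((projT2 (projT2 z).2).1 : hom _ (_ ⊗ B ord0)) ;;
      whisk (B ord0) (projT2 (projT2 z).2).2
  | m'.+1 => fun A B P Q z =>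
      existT _ (projT1 (projT2 z).2)
        (((projT2 z).1 : hom (P ⊗ A ord0) _) ;;
         ((projT2 (projT2 z).2).1 : hom _ (_ ⊗ B ord0)),
         fuse (projT2 (projT2 z).2).2)
  end.

Lemma comb_ofK m (A B : 'I_m.+1 -> AA) P Q (c : links A B P Q) : fuse (comb_of c) = c.
Proof.
elim: m A B P Q c => [|m IH] A B P Q c /=; first by rewrite whisk_id mcomp1m mcompm1.
by case: c => K [f c] /=; rewrite mcomp1m IH.
Qed.

Lemma fuseK m (A B : 'I_m.+1 -> AA) P Q (z : comb (word A B) P Q) :
  comb_eq (comb_of (fuse z)) z.
Proof.
elim: m A B P Q z => [|m IH] A B P Q [L [f [K [g r]]]].
  refine (comb_trans _ (comb_sym (glue_tooth f g (r : comb [::] K Q)))).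
  refine (comb_trans (tooth_slide _ _ _) _).
  by rewrite /= mcompm1; apply: rst_refl.
by apply: comb_trans (tooth_eq _ (IH _ _ _ _ _)) (comb_sym (glue_tooth f g _)).
Qed.

(** The arrows k slide one after the other, from the last link to the first. *)
Lemma shift_comb m (A B : 'I_m.+1 -> AA) P P' Q (h : hom P P')
    (c : links A B P Q) (c' : links A B P' Q) :
  shift h c c' -> comb_eq (comb_of c) (lact h (comb_of c')).
Proof.
elim: m A B P P' Q h c c' => [|m IH] A B P P' Q h.
  by move=> _ c' ->; exact (lact_tooth h c' (idm Q : comb [::] Q Q)).
move=> [L [f c]] [N [g c']] /= [x [k [fx gx cc]]]; subst.
pose c1 : links (rest A) (rest B) L Q := c; pose c2 : links (rest A) (rest B) N Q := c'.
change (comb_eq (tooth (whisk (A ord0) h ;; x) (comb_of c1))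
  (lact h (tooth (x ;; whisk (B ord0) k) (comb_of c2)))).
apply: comb_trans (lact_tooth _ _ _) (lact_eq _ _).
by apply: comb_trans (tooth_eq _ (IH _ _ _ _ _ _ _ _ cc)) (comb_sym (tooth_slide _ _ _)).
Qed.

Lemma shift_fuse m (A B : 'I_m.+1 -> AA) P P' Q (h : hom P P') (z :
  comb (word A B) P' Q) :
  shift h (fuse (lact h z)) (fuse z).
Proof.
case: m A B P P' Q h z => [|m] A B P P' Q h z /=; first by rewrite !mcompA.
exists ((projT2 z).1 ;; (projT2 (projT2 z).2).1), (idm _).
by rewrite whisk_id mcompm1 mcompA; split=> //; apply: shift_refl.
Qed.

(** A slide inside a pair A•, B° leaves the composite unchanged; a slide between
    two pairs is a step that moves one inner object only. *)
Lemma fuse_eq m (A B : 'I_m.+1 -> AA) P Q (z z' : comb (word A B) P Q) :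
  comb_eq z z' -> links_eq (fuse z) (fuse z').
Proof.
elim: m A B P Q z z' => [|m IH] A B P Q z z' zz.
  have -> : fuse z = fuse z'; last exact: rst_refl.
  apply: rst_eq zz => _ _ [K K' f h r|K f r r' rr] /=; first by rewrite !mcompA.
  rewrite -!mcompA; congr mcomp.
  apply: (rst_eq (f := fun r : comb [:: (B ord0, circ)] K Q =>
    ((projT2 r).1 : hom _ (_ ⊗ B ord0)) ;; whisk (B ord0) (projT2 r).2)) rr =>
      _ _ [L L' g h s|L g s s' ss] /=.
    by rewrite whisk_comp mcompA.
  by rewrite ss.
apply: rst_map zz => {z z'} _ _ [K K' f h r|K f r r' rr] /=.
  by rewrite mcompA; apply: rst_refl.
pose F (s : comb ((B ord0, circ) :: word (rest A) (rest B)) K Q) : links A B P Q :=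
  existT _ (projT1 s) ((f : hom (P ⊗ A ord0) _) ;; ((projT2 s).1 : hom _ (_ ⊗ B ord0)),
                       fuse (projT2 s).2).
refine (rst_map (S := shift (idm P)) (f := F) _ rr) => _ _ [L L' g h s|L g s s' ss].
  apply: rst_sym; apply: rst_step; exists (f ;; g), h.
  split; first by rewrite whisk_id mcomp1m.
    exact: mcompA.
  exact: shift_fuse.
pose G (c : links (rest A) (rest B) L Q) : links A B P Q := existT _ L (f ;; g, c).
refine (rst_map (S := shift (idm P)) (f := G) _ (IH _ _ _ _ _ _ ss)) => c c' cc.
by apply: rst_step; exists (f ;; g), (idm _); rewrite !whisk_id mcomp1m mcompm1.
Qed.

Lemma links_combP m (A B : 'I_m.+1 -> AA) P Q (c c' : links A B P Q) :
  links_eq c c' <-> comb_eq (comb_of c) (comb_of c').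
Proof.
split=> [|/fuse_eq]; last by rewrite !comb_ofK.
elim=> {c c'} [c c' /shift_comb|c|c c' _|c c' c'' _ cc _]; rewrite ?lact_id //.
- exact: comb_refl.
- exact: comb_sym.
- exact: comb_trans.
Qed.

(** * Tuples indexed by ordinals *)

Definition gext n P (M : 'I_n -> AA) (o : option 'I_n) : AA :=
    if o is Some j then M j else P.

Definition gext_hom n P P' (h : hom P P') (L N : 'I_n -> AA)
    (k : forall j, hom (L j) (N j))
    (o : option 'I_n) : hom (gext P L o) (gext P' N o) :=
  if o is Some j then k j else h.

(** With P and Q both the unit this is [chain_ob] by conversion.  General ends
    are needed to remove the first link, and distinct families N and L to
    describe a step of the coend by one off-diagonal element. *)
Definition gchain m (A B : 'I_m.+1 -> AA) P Q (N L : 'I_m -> AA) : Type :=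
  forall i : 'I_m.+1,
    hom (gext P N (unlift ord0 i) ⊗ A i) (gext Q L (unlift ord_max i) ⊗ B i).

(** The two diagonal elements identified by the coend; k is taken along the
    sources here and along the targets in [postcompose]. *)
Definition precompose m (A B : 'I_m.+1 -> AA) P P' Q (h : hom P P') (L N : 'I_m -> AA)
    (k : forall j, hom (L j) (N j)) (x : gchain A B P' Q N L) : gchain A B P Q L L :=
  fun i => whisk (A i) (gext_hom h k (unlift ord0 i)) ;; x i.

Definition postcompose m (A B : 'I_m.+1 -> AA) P Q (L N : 'I_m -> AA)
    (k : forall j, hom (L j) (N j)) (x : gchain A B P Q N L) : gchain A B P Q N N :=
  fun i => x i ;; whisk (B i) (gext_hom (idm Q) k (unlift ord_max i)).

Lemma unlift_max1 : unlift ord_max (ord0 : 'I_1) = None.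
Proof. by case: (unlift _ _) => // - []. Qed.

Lemma unlift_max0 m : unlift ord_max (ord0 : 'I_m.+2) = Some ord0.
Proof.
have -> : (ord0 : 'I_m.+2) = lift ord_max ord0 by apply: val_inj.
exact: liftK.
Qed.

Lemma unlift_maxS m (i : 'I_m.+1) :
  unlift ord_max (lift ord0 i : 'I_m.+2) = omap (lift ord0) (unlift ord_max i).
Proof.
case: (unliftP ord_max i) => [j|] -> /=.
  have -> : lift ord0 (lift ord_max j) = lift ord_max (lift ord0 j) :> 'I_m.+2.
    by apply: val_inj; rewrite /= /bump /= !add1n ltnS addnS.
  by rewrite liftK.
have -> : lift ord0 ord_max = ord_max :> 'I_m.+2 by apply: val_inj.
by rewrite unlift_none.
Qed.

Lemma gext_head n P (N : 'I_n -> AA) : gext P N (unlift ord0 ord0) = P.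
Proof. by rewrite unlift_none. Qed.

Lemma gext_last Q (L : 'I_0 -> AA) : gext Q L (unlift ord_max ord0) = Q.
Proof. by case: (unlift _ _) => // - []. Qed.

Lemma gext_max0 m Q (L : 'I_m.+1 -> AA) : gext Q L (unlift ord_max ord0) = L ord0.
Proof. by rewrite unlift_max0. Qed.

Lemma gext_tail m P (N : 'I_m.+1 -> AA) (i : 'I_m.+1) :
  gext P N (unlift ord0 (lift ord0 i)) = gext (N ord0) (rest N) (unlift ord0 i).
Proof. by rewrite liftK; case: (unliftP ord0 i) => [j|] ->. Qed.

Lemma gext_maxS m Q (L : 'I_m.+1 -> AA) (i : 'I_m.+1) :
  gext Q L (unlift ord_max (lift ord0 i)) = gext Q (rest L) (unlift ord_max i).
Proof. by rewrite unlift_maxS; case: (unlift _ _). Qed.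

Definition tcast (A B P P' Q Q' : AA) (eP : P = P') (eQ : Q = Q')
    (f : hom (P ⊗ A) (Q ⊗ B)) : hom (P' ⊗ A) (Q' ⊗ B) :=
  hom_cast (f_equal (tens^~ A) eP) (f_equal (tens^~ B) eQ) f.

(** [unlift] does not compute on [ord0] and [lift], so removing the first link
    transports along the equations above; the packed arrows are unchanged. *)
Definition first_link m (A B : 'I_m.+2 -> AA) P Q N L (x : gchain A B P Q N L) :
    hom (P ⊗ A ord0) (L ord0 ⊗ B ord0) :=
  tcast (gext_head P N) (gext_max0 Q L) (x ord0).

Definition later_links m (A B : 'I_m.+2 -> AA) P Q N L (x : gchain A B P Q N L) :
    gchain (rest A) (rest B) (N ord0) Q (rest N) (rest L) :=
  fun i => tcast (gext_tail P N i) (gext_maxS Q L i) (x (lift ord0 i)).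

Definition sole_link (A B : 'I_1 -> AA) P Q N L (x : gchain A B P Q N L) :
    hom (P ⊗ A ord0) (Q ⊗ B ord0) :=
  tcast (gext_head P N) (gext_last Q L) (x ord0).

Fixpoint links_of m : forall (A B : 'I_m.+1 -> AA) P Q M, gchain A B P Q M M ->
    links A B P Q :=
  match m return forall (A B : 'I_m.+1 -> AA) P Q M, gchain A B P Q M M ->
    links A B P Q with
  | 0 => fun A B P Q M x => sole_link x
  | m'.+1 => fun A B P Q M x => existT _ (M ord0) (first_link x, links_of (later_links x))
  end.

Lemma arr_gext_tail m P P' (h : hom P P') (L N : 'I_m.+1 -> AA)
    (k : forall j, hom (L j) (N j)) (i : 'I_m.+1) :
  arr (gext_hom h k (unlift ord0 (lift ord0 i)))
  = arr (gext_hom (k ord0) (fun j => k (lift ord0 j) :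
    hom (rest L j) (rest N j)) (unlift ord0 i)).
Proof. by rewrite liftK; case: (unliftP ord0 i) => [j|] ->. Qed.

Lemma arr_gext_maxS m Q (L N : 'I_m.+1 -> AA)
    (k : forall j, hom (L j) (N j)) (i : 'I_m.+1) :
  arr (gext_hom (idm Q) k (unlift ord_max (lift ord0 i)))
  = arr (gext_hom (idm Q) (fun j => k (lift ord0 j) :
    hom (rest L j) (rest N j)) (unlift ord_max i)).
Proof. by rewrite unlift_maxS; case: (unlift _ _). Qed.

(** Steps of the coend are steps between links.  Both sides take apart the same
    off-diagonal element. *)
Lemma shift_links_of m (A B : 'I_m.+1 -> AA) P P' Q (h : hom P P') (L N : 'I_m -> AA)
    (k : forall j, hom (L j) (N j)) (x : gchain A B P' Q N L) :
  shift h (links_of (precompose h k x)) (links_of (postcompose k x)).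
Proof.
elim: m A B P P' Q h L N k x => [|m IH] A B P P' Q h L N k x.
  apply: arr_inj; rewrite arr_cast /precompose.
  apply: arr_mcomp; first by rewrite unlift_none.
  rewrite arr_cast; apply/esym/arr_mcompm1.
  by rewrite unlift_max1 /= whisk_id.
exists (first_link x), (k ord0); split.
- apply: arr_inj; rewrite arr_cast; apply: arr_mcomp; last by rewrite arr_cast.
  by rewrite unlift_none.
- apply: arr_inj; rewrite arr_cast; apply: arr_mcomp; first by rewrite arr_cast.
  by rewrite unlift_max0.
- pose k' j : hom (rest L j) (rest N j) := k (lift ord0 j).
  have -> : (projT2 (links_of (precompose h k x))).2
    = links_of (precompose (k ord0) k' (later_links x)).
    congr links_of; apply: functional_extensionality_dep => i; apply: arr_inj.
    rewrite arr_cast; apply: arr_mcomp; last by rewrite arr_cast.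
    by apply: arr_whisk; apply: arr_gext_tail.
  have -> : (projT2 (links_of (postcompose k x))).2
    = links_of (postcompose k' (later_links x)).
    congr links_of; apply: functional_extensionality_dep => i; apply: arr_inj.
    rewrite arr_cast; apply: arr_mcomp; first by rewrite arr_cast.
    by apply: arr_whisk; apply: arr_gext_maxS.
  exact: IH.
Qed.

(** Adding a first link.  The option stands for [unlift ord0 i], which tells
    whether i is the first index: on options the case analysis computes, and
    the result is transported to the types of the components afterwards. *)
Definition gcons_case m (A B : 'I_m.+2 -> AA) P Q K K' N L
    (f : hom (P ⊗ A ord0) (K' ⊗ B ord0)) (y : gchain (rest A) (rest B) K Q N L)
    (o : option 'I_m.+1) :
    hom (if o is Some j then gext K N (unlift ord0 j) ⊗ A (lift ord0 j) else P ⊗ A ord0)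
        (if o is Some j then gext Q L (unlift ord_max j) ⊗ B (lift ord0 j) else K'
          ⊗ B ord0) :=
  if o is Some j then y j else f.

Definition ocons n K (N : 'I_n -> AA) : 'I_n.+1 -> AA :=
  fun i =>
    gext K N (unlift ord0 i).

Lemma gcons_src m (A : 'I_m.+2 -> AA) P K (N : 'I_m -> AA) (i : 'I_m.+2) :
  (if unlift ord0 i is Some j then gext K N (unlift ord0 j) ⊗ A (lift ord0 j)
    else P ⊗ A ord0)
  = gext P (ocons K N) (unlift ord0 i) ⊗ A i.
Proof. by case: (unliftP ord0 i) => [j|] ->. Qed.

Lemma gcons_tgt m (B : 'I_m.+2 -> AA) Q K (L : 'I_m -> AA) (i : 'I_m.+2) :
  (if unlift ord0 i is Some j then gext Q L (unlift ord_max j) ⊗ B (lift ord0 j)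
    else K ⊗ B ord0)
  = gext Q (ocons K L) (unlift ord_max i) ⊗ B i.
Proof.
case: (unliftP ord0 i) => [j|] ->; last by rewrite gext_max0 /ocons gext_head.
rewrite gext_maxS; congr tens; case: (unlift _ _) => //= l.
by rewrite /rest /ocons liftK.
Qed.

Definition gcons m (A B : 'I_m.+2 -> AA) P Q K K' N L
    (f : hom (P ⊗ A ord0) (K' ⊗ B ord0)) (y : gchain (rest A) (rest B) K Q N L) :
    gchain A B P Q (ocons K N) (ocons K' L) :=
  fun i => hom_cast (gcons_src A P K N i) (gcons_tgt B Q K' L i)
    (gcons_case f y (unlift ord0 i)).

Lemma arr_gcons0 m (A B : 'I_m.+2 -> AA) P Q K K' N L
    (f : hom (P ⊗ A ord0) (K' ⊗ B ord0)) (y : gchain (rest A) (rest B) K Q N L) :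
  arr (gcons f y ord0) = arr f.
Proof. by rewrite arr_cast unlift_none. Qed.

Lemma arr_gconsS m (A B : 'I_m.+2 -> AA) P Q K K' N L
    (f : hom (P ⊗ A ord0) (K' ⊗ B ord0)) (y : gchain (rest A) (rest B) K Q N L) j :
  arr (gcons f y (lift ord0 j)) = arr (y j).
Proof. by rewrite arr_cast liftK. Qed.

Lemma existT_links m (A B : 'I_m.+2 -> AA) P Q K K' (f : hom (P ⊗ A ord0) (K ⊗ B ord0))
    (f' : hom (P ⊗ A ord0) (K' ⊗ B ord0)) (c : links (rest A) (rest B) K Q)
    (c' : links (rest A) (rest B) K' Q) :
  arr f = arr f' ->
  existT (fun K => links (rest A) (rest B) K Q) K c = existT _ K' c' ->
  existT (fun K => hom (P ⊗ A ord0) (K ⊗ B ord0) * links (rest A) (rest B) K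
    Q)%type K (f, c)
  = existT _ K' (f', c').
Proof.
move=> ff cc; have eK : K = K' := f_equal (@projT1 _ _) cc.
by subst; rewrite (arr_inj ff) (inj_pairT2 _ _ _ _ _ cc).
Qed.

(** [rest] and [ocons] cancel only up to equality, so the left ends may differ
    and are packed with the links. *)
Lemma links_of_eq m (A B : 'I_m.+1 -> AA) P P' Q M M'
    (x : gchain A B P Q M M) (x' : gchain A B P' Q M' M') :
  P = P' -> M =1 M' -> (forall i, arr (x i) = arr (x' i)) ->
  existT (fun P => links A B P Q) P (links_of x) = existT _ P' (links_of x').
Proof.
move=> eP /functional_extensionality eM; subst => xx.
by congr existT; congr links_of; apply: functional_extensionality_dep => i;
  apply: arr_inj.
Qed.

(** Every step between links comes from an off-diagonal element.  Applied to
    the reflexive step this also shows that all links come from a tuple. *)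
Lemma shift_lift m (A B : 'I_m.+1 -> AA) P P' Q (h : hom P P') c c' :
  shift h c c' -> exists L N (k : forall j, hom (L j) (N j)) (x : gchain A B P' Q N L),
    links_of (precompose h k x) = c /\ links_of (postcompose k x) = c'.
Proof.
elim: m A B P P' Q h c c' => [|m IH] A B P P' Q h.
  move=> _ c' ->.
  pose M (j : 'I_0) : AA := P.
  have src i : P' ⊗ A ord0 = gext P' M (unlift ord0 i) ⊗ A i.
    by rewrite (ord1 i) gext_head.
  have tgt i : Q ⊗ B ord0 = gext Q M (unlift ord_max i) ⊗ B i.
    by rewrite (ord1 i) gext_last.
  exists M, M, (fun j => idm (M j)), (fun i => hom_cast (src i) (tgt i) c').
  split; apply: arr_inj; rewrite arr_cast; last first.
    rewrite -[RHS](arr_cast (src ord0) (tgt ord0)); apply: arr_mcompm1.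
    by rewrite unlift_max1 /= whisk_id.
  apply: arr_mcomp; last by rewrite arr_cast.
  by rewrite unlift_none.
move=> [L0 [f c]] [N0 [g c']] /= [y [k0 [fy gy]]] /IH [L [N [k [x [cx cx']]]]].
subst; pose k' j : hom (ocons L0 L j) (ocons N0 N j) := gext_hom k0 k (unlift ord0 j).
exists (ocons L0 L), (ocons N0 N), k', (gcons y x).
have k'0 : arr (k' ord0) = arr k0
  by change (arr (gext_hom k0 k (unlift ord0 ord0)) = arr k0); rewrite unlift_none.
have k'S j : arr (k' (lift ord0 j)) = arr (k j).
  by change (arr (gext_hom k0 k (unlift ord0 (lift ord0 j))) = arr (k j)); rewrite liftK.
have restE K M : rest (ocons K M) =1 M :> ('I_m -> AA) by move=> j;
  rewrite /rest /ocons liftK.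
split; apply: existT_links.
- rewrite arr_cast; apply: arr_mcomp (arr_gcons0 _ _).
  by rewrite unlift_none.
- apply: links_of_eq => [||i]; [exact: gext_head | exact: restE | rewrite arr_cast].
  apply: arr_mcomp (arr_gconsS _ _ _).
  by apply: arr_whisk; rewrite liftK.
- rewrite arr_cast; apply: arr_mcomp (arr_gcons0 _ _) _.
  by rewrite unlift_max0; apply: arr_whisk.
- apply: links_of_eq => [||i]; [exact: gext_head | exact: restE | rewrite arr_cast].
  apply: arr_mcomp (arr_gconsS _ _ _) _.
  by apply: arr_whisk; rewrite unlift_maxS; case: (unlift _ _) => //= j; apply: k'S.
Qed.

(** The inner objects are recorded in the links, so that M is recovered even
    though tensoring need not be injective on objects. *)
Lemma links_of_inj m (A B : 'I_m.+1 -> AA) P P' Q M M'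
    (x : gchain A B P Q M M) (x' : gchain A B P' Q M' M') :
  existT (fun P => links A B P Q) P (links_of x) = existT _ P' (links_of x') ->
  M = M' /\ forall i, arr (x i) = arr (x' i).
Proof.
elim: m A B P P' Q M M' x x' => [|m IH] A B P P' Q M M' x x' xx;
  have eP : P = P' := f_equal (@projT1 _ _) xx; subst;
  have {}xx := inj_pairT2 _ _ _ _ _ xx.
  split=> [|i]; first by apply: functional_extensionality => - [].
  by have := f_equal (@arr _ _ _) xx; rewrite !arr_cast (ord1 i).
have hh : arr (first_link x) = arr (first_link x') :=
  f_equal (fun c : links A B P' Q => arr (projT2 c).1) xx.
have /IH [eM tt] := f_equal (fun c : links A B P' Q =>
  existT (fun K => links (rest A) (rest B) K Q) (projT1 c) (projT2 c).2) xx.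
have e0 : M ord0 = M' ord0 := f_equal (@projT1 _ _) xx.
split=> [|i].
  apply: functional_extensionality => i; case: (unliftP ord0 i) => [j|] -> //.
  exact (f_equal (fun F : 'I_m -> AA => F j) eM).
have [[j ->]|->] : (exists j : 'I_m.+1, i = lift ord0 j) \/ i = ord0; last 2 first.
- by have := tt j; rewrite !arr_cast.
- by move: hh; rewrite !arr_cast.
by case: (unliftP ord0 i) => [j|] ->; [left; exists j | right].
Qed.

Section Coend.
Variables (m : nat) (A B : 'I_m.+1 -> AA).

Definition chain_links (c : {M : power 'I_m AA & chain A B M M}) :
  links A B unito unito :=
  @links_of m A B unito unito (projT1 c) (projT2 c).

Lemma chain_links_inj : injective chain_links.
Proof.
move=> [M x] [M' x'] /= xx.
have [eM ax] : M = M' /\ forall i, arr (x i) = arr (x' i).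
  exact (links_of_inj (f_equal (existT (fun P => links A B P unito) unito) xx)).
case: _ / eM x' ax {xx} => x' ax; congr existT.
by apply: functional_extensionality_dep => i; apply: arr_inj.
Qed.

Lemma chain_act_precompose (L N : power 'I_m AA) (k : hom L N) (x : chain_ob A B N L) :
  chain_act k (idm L) x = precompose (idm unito) k (x : gchain A B unito unito N L).
Proof.
apply: functional_extensionality_dep => i.
by rewrite /chain_act ext_hom_id tensm_id mcompm1.
Qed.

Lemma chain_act_postcompose (L N : power 'I_m AA) (k : hom L N) (x : chain_ob A B N L) :
  chain_act (idm N) k x = postcompose k (x : gchain A B unito unito N L).
Proof.
apply: functional_extensionality_dep => i.
by rewrite /chain_act ext_hom_id tensm_id mcomp1m.
Qed.

Lemma chain_links_step c c' :
  coend_step (F := chain A B) c c' <-> shift (idm unito) (chain_links c) (chain_links c').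
Proof.
split=> [[L N k x]|/shift_lift [L [N [k [x [xc xc']]]]]].
  rewrite /chain_links /= chain_act_precompose chain_act_postcompose.
  exact: shift_links_of.
have -> : c = existT (fun M : power 'I_m AA =>
  chain A B M M) L (@chain_act AA m A B L N L L k (@idm (power 'I_m AA) L) x).
  by apply: chain_links_inj; rewrite -xc /chain_links /= chain_act_precompose.
have -> : c' = existT (fun M : power 'I_m AA =>
  chain A B M M) N (@chain_act AA m A B N N L N (@idm (power 'I_m AA) N) k x).
  by apply: chain_links_inj; rewrite -xc' /chain_links /= chain_act_postcompose.
exact: (@CoendStep _ (chain A B) L N k x).
Qed.

Lemma chain_links_surj c : exists x, chain_links x = c.
Proof.
have /shift_lift [L [N [k [x [<- _]]]]] := shift_refl c.
by exists (existT (fun M : power 'I_m AA =>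
  chain_ob A B M M) L (precompose (idm unito) k x)).
Qed.

Lemma chain_linksP c c' :
  clos_refl_sym_trans _ (coend_step (F := chain A B)) c c' <->
  links_eq (chain_links c) (chain_links c').
Proof.
split; first by apply: rst_map => {c c'} c c' /chain_links_step; apply: rst_step.
move=> cc.
suff H d d' : links_eq d d' -> forall c c', chain_links c = d -> chain_links c' = d' ->
    clos_refl_sym_trans _ (coend_step (F := chain A B)) c c' by apply: H cc _ _ _ _.
elim=> {d d' c c' cc} [d d' dd|d|d d' _ IH|d d' d'' _ IH _ IH'] c c' cd cd'.
- by apply: rst_step; apply/chain_links_step; rewrite cd cd'.
- by rewrite (chain_links_inj (etrans cd (esym cd'))); apply: rst_refl.
- exact/rst_sym/IH.
- have [e ed] := chain_links_surj d'.
  by apply: rst_trans (IH _ _ cd ed) (IH' _ _ ed cd').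
Qed.

End Coend.
End Links.

Theorem lemma2 (AA : strictMonoidal) (m : nat) (A B : 'I_m.+1 -> AA) :
  exists phi :
      cornering [::] unito unito
        (\big[cat/[::]]_(i < m.+1) [:: (A i, bullet); (B i, circ)])
      -> coend (chain A B),
    bijective phi.
Proof.
rewrite big_word.
(* Cells and tuples are compared as combs from I to I; the image of the
   identity of I is a comb from I ⊗ I to I ⊗ I. *)
pose f (a : cell [::] unito unito (word A B)) : comb (word A B) unito unito :=
  lact (idc (esym (tenso1 unito)))
    (ract (sem a (idm unito : comb [::] _ _)) (idc (tenso1 unito))).
have fE a : sim (f a) (sem a (idm unito : comb [::] _ _)).
  exact: sim_trans (sim_lact_idc _ _) (sim_ract_idc _ _).
apply: (@quotient_cospan _ _ _ _ _ (@comb_eq _ (word A B) unito unito) f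
   (fun c => comb_of (chain_links c))).
- exact: comb_refl.
- exact: comb_sym.
- exact: comb_trans.
- move=> a b; split=> [/cell_eq_sem ab|ab].
    by apply: sim_comb_eq; apply: sim_trans (fE a) (sim_trans ab (sim_sym (fE b))).
  apply/cell_eq_sem.
  exact: sim_trans (sim_sym (fE a)) (sim_trans (Sim ab) (fE b)).
- by move=> c c'; split=> [/chain_linksP/links_combP|/links_combP/chain_linksP].
- move=> w; exists (realize w); apply: sim_comb_eq.
  exact: sim_trans (fE _) (sem_realize w).
- move=> w; have [c cw] := chain_links_surj (fuse w).
  by exists c; rewrite cw; apply: fuseK.
Qed.
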